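(* Let $G$ be a biconnected network with $n$ nodes, let $A$ be an asynchronous protocol solving the Black Hole Search problem on $G$ that requires at most $t$ agents and at most $m$ moves, and let $\pi$ be a traversal pair of $G$. For any $0<\delta\le 1$ there exists a protocol $A_r$ for the rB-hole Search problem on $G$ that requires at most $2t+2$ agents and $O(m+s(\pi)+\Delta n)$ moves, where $\Delta=\log_{1-p}\delta\approx O\!\left(\frac{\log (1/\delta)}{p}\right)$. The protocol $A_r$ always terminates and reports the correct output with probability at least $1-\delta$.
   Context: Network and agents. The network is a connected undirected graph $G$ whose nodes may be anonymous. Agents are computational entities with bounded local memory that move along links between adjacent nodes and run a common protocol. Every node carries a whiteboard: a shared memory of $O(\log n)$ bits that agents at that node can read and write in mutual exclusion; whiteboards are the only means of communication. Agents are asynchronous: each action (computation step or move on a link) takes finite but unpredictable time, with no bound. All agents start at a common safe node $h$, the homebase. Numbers of moves and agents are worst-case totals. Black hole and rB-hole. A black hole is a stationary process located at a node that destroys every agent arriving there, leaving no observable trace. An rB-hole is located at a node and has a killing probability: (1) when an agent moves from a safe node to the rB-hole, a biased coin is flipped and the agent is killed with that probability, without trace; (2) if it survives, it accesses the whiteboard of that node (if there is one) and can safely modify it; (3) when it moves from the rB-hole to a safe node, another coin is flipped and it is killed with the same probability, otherwise it leaves safely. A black hole is an rB-hole with killing probability $1$. Problems. It is given that exactly one node (different from $h$) contains the black hole (resp. rB-hole). The Black Hole Search problem (resp. rB-hole Search problem) asks for a protocol coordinating the agents so that after a finite number of moves at least one agent survives and reports the location of the black hole (resp. rB-hole). A protocol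 for Black Hole Search always terminates with at least one surviving agent reporting the right output at the homebase. For rB-hole Search the output may be wrong with a bounded error probability. It is assumed that every agent knows the full topology of the graph and knows a lower bound $p$, $0<p\le 1$, on the killing probability of the rB-hole; $\delta$ is a user-specified error bound. For $p=1$, $\log_{1-p}\delta$ is read as $0$. Traversal pairs. Let $v_1,\ldots,v_n$ be a total ordering of the nodes of a biconnected graph $G$. A $u$-$v$ traversal pair with respect to this ordering is a pair $\pi=(\pi_l,\pi_r)$ of paths (walks) in $G$ starting from $u=v_1$ and $v=v_n$ respectively and exploring the nodes (i.e. visiting them for the first time) in the order $v_1,v_2,\ldots,v_n$ and $v_n,v_{n-1},\ldots,v_1$ respectively. The pair $\pi$ is taken to be an $h$-$v$ traversal pair, where $h$ is the homebase and $v$ one of its neighbours; it is fixed and shared by all agents. Its size is $s(\pi)=\max\{|\pi_l|,|\pi_r|\}$, where $|\gamma|$ is the number of edges of $\gamma$. *)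

(* Defs.v *)
From mathcomp Require Import all_boot all_order all_algebra.
From mathcomp Require Import all_classical all_reals all_analysis.

Set Implicit Arguments.
Unset Strict Implicit.
Unset Printing Implicit Defensive.

Import Order.TTheory GRing.Theory Num.Theory.

Local Open Scope ring_scope.

(* A network is a finite type of nodes [V] with a symmetric irreflexive
   adjacency relation [e]. *)

Definition biconnected (V : finType) (e : rel V) : Prop :=
  (forall u v, connect e u v) /\
  (forall z u v, u != z -> v != z ->
     connect [rel a b | [&& e a b, a != z & b != z]] u v).

(* [undup] keeps the last occurrence of each item, hence the two reversals. *)
Definition first_visits (V : eqType) (w : seq V) : seq V := rev (undup (rev w)).

(* The walks are [u :: pi.1] and [v :: pi.2], so that [size pi.1] and
   [size pi.2] are their numbers of edges.  The last two conditions force the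
   ordering to start with [u] and to end with [v]. *)
Definition traversal_pair (V : finType) (e : rel V) (u v : V)
    (pi : seq V * seq V) : Prop :=
  exists vs : seq V,
    [/\ perm_eq vs (enum V),
        path e u pi.1,
        path e v pi.2,
        first_visits (u :: pi.1) = vs &
        first_visits (v :: pi.2) = rev vs].

Definition traversal_size (V : Type) (pi : seq V * seq V) : nat :=
  maxn (size pi.1) (size pi.2).

Variant action (V : Type) :=
| Stay
| Move of V
| Report of V.
Arguments Stay {V}.

(* All agents start with the same memory and run the same program.  In one
   atomic step an agent reads the whiteboard of its node, updates its memory
   and this whiteboard, and chooses an action.  The program may depend on the
   current node and names its destinations: an agent that knows the graph and
   the common starting node can keep track of its position, even when the nodes
   carry no identifiers.  All whiteboards have the same initial content. *)
Record protocol (V : finType) := Protocol {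
  nagents : nat;
  nagents_gt0 : (0 < nagents)%N;
  memory : finType;
  board : finType;
  memory0 : memory;
  board0 : board;
  program : V -> memory -> board -> memory * board * action V
}.

(* An agent that has reported stays, alive, at the homebase. *)
Variant agent_state (V M : Type) :=
| At of V & M
| InTransit of V & V & M
| Killed
| Reported of V.
Arguments Killed {V M}.
Arguments Reported {V M}.

Section Executions.
Variables (V : finType) (e : rel V) (h : V) (P : protocol V).

Record config := Config {
  agents : {ffun 'I_(nagents P) -> agent_state V (memory P)};
  boards : {ffun V -> board P};
  moves : nat
}.

Definition config0 : config :=
  Config [ffun=> At h (memory0 P)] [ffun=> board0 P] 0.

(* Moves to non-adjacent nodes and reports away from the homebase have no
   effect on the location of the agent. *)
Definition act (v : V) (s : memory P) (ac : action V) :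
    agent_state V (memory P) :=
  match ac with
  | Stay => At v s
  | Move w => if e v w then InTransit v w s else At v s
  | Report w => if v == h then Reported w else At v s
  end.

Definition set_agent (cf : config) (a : 'I_(nagents P))
    (st : agent_state V (memory P)) :
    {ffun 'I_(nagents P) -> agent_state V (memory P)} :=
  [ffun b => if b == a then st else agents cf b].

(* [x] is the node of the rB-hole, [a] the scheduled agent and [kill] the coin
   of this step, which matters only if the agent completes a move into or out
   of [x]. *)
Definition step (x : V) (a : 'I_(nagents P)) (kill : bool) (cf : config) :
    config :=
  match agents cf a with
  | At v s =>
      let: (s', b', ac) := program v s (boards cf v) in
      Config (set_agent cf a (act v s' ac))
             [ffun w => if w == v then b' else boards cf w]
             (moves cf)
  | InTransit u v s =>
      Config (set_agent cf a
                (if ((u == x) || (v == x)) && kill then Killed else At v s))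
             (boards cf) (moves cf).+1
  | Killed | Reported _ => cf
  end.

(* Asynchrony: the adversary chooses the next agent to be scheduled, knowing
   all the coins flipped so far (and hence, agents being deterministic, the
   whole execution so far).  The coin of step [i] is [coin i], [true] meaning
   that it kills. *)
Definition adversary := seq bool -> 'I_(nagents P).

Fixpoint run (x : V) (adv : adversary) (coin : nat -> bool) (i : nat) : config :=
  if i is j.+1
  then step x (adv (mkseq coin j)) (coin j) (run x adv coin j)
  else config0.

Definition reported (cf : config) (w : V) : Prop :=
  exists a, agents cf a = Reported w.

Definition terminates (r : nat -> config) : Prop :=
  exists i w, reported (r i) w.

Definition correct_output (x : V) (r : nat -> config) : Prop :=
  (exists i, reported (r i) x) /\ (forall i w, reported (r i) w -> w = x).

End Executions.

Section Problems.
Variable R : realType.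

(* The coin sequences that can occur with killing probability [q > 0]. *)
Definition possible_coins (q : R) (coin : nat -> bool) : Prop :=
  q = 1 -> forall i, coin i.

(* Every action takes a finite time. *)
Definition fair (V : finType) (P : protocol V) (q : R) (adv : adversary P) :
    Prop :=
  forall coin, possible_coins q coin ->
  forall (a : 'I_(nagents P)) (i : nat),
    exists2 j, (i <= j)%N & adv (mkseq coin j) = a.

(* Independent coins, each of them killing with probability [q]. *)
Definition independent_coins (d : measure_display) (Omega : measurableType d)
    (Pr : probability Omega R) (q : R) (coin : nat -> Omega -> bool) : Prop :=
  (forall i, measurable [set w | coin i w]%classic) /\
  (forall (N : nat) (b : nat -> bool),
     Pr [set w | forall i, (i < N)%N -> coin i w = b i]%classic =
     (\prod_(i < N) (if b i then q else 1 - q))%:E).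

(* A black hole is an rB-hole with killing probability 1. *)
Definition solves_BHS (V : finType) (e : rel V) (h : V) (A : protocol V)
    (t m : nat) : Prop :=
  (nagents A <= t)%N /\
  forall x, x != h -> forall adv : adversary A, fair (1 : R) adv ->
  forall coin, possible_coins (1 : R) coin ->
    correct_output x (run e h x adv coin) /\
    forall i, (moves (run e h x adv coin i) <= m)%N.

Definition solves_rBHS (V : finType) (e : rel V) (h : V) (A : protocol V)
    (p delta : R) (t : nat) (m : R) : Prop :=
  (nagents A <= t)%N /\
  forall x, x != h -> forall q : R, p <= q <= 1 ->
  forall adv : adversary A, fair q adv ->
    (forall coin, possible_coins q coin ->
       terminates (run e h x adv coin) /\
       forall i, (moves (run e h x adv coin i))%:R <= m) /\
    (forall (d : measure_display) (Omega : measurableType d)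
            (Pr : probability Omega R) (coin : nat -> Omega -> bool),
       independent_coins Pr q coin ->
       ((1 - delta)%:E <=
        Pr [set w | correct_output x (run e h x adv (coin ^~ w))]%classic)%E).

(* log_{1-p} delta *)
Definition Delta (p delta : R) : R :=
  if p == 1 then 0 else ln delta / ln (1 - p).

End Problems.

(* Main.v *)
Require Import Defs.
From HB Require Import structures.
From mathcomp Require Import all_boot all_order all_algebra.
From mathcomp Require Import all_classical all_reals all_analysis.
From mathcomp Require Import zify lra.
Import Order.TTheory GRing.Theory Num.Theory.

Set Implicit Arguments.
Unset Strict Implicit.
Unset Printing Implicit Defensive.

(* The protocol runs two copies of [A] next to two explorers.  Let u_0, ..., u_n
   be the nodes other than [h] in the order of the traversal pair: explorer
   [false] clears them in this order, explorer [true] in the reverse order.  On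
   reaching its next target an explorer first claims it, unless the other one
   already did: then every other node has been passed, and it walks back to [h]
   and reports this target.  After claiming the target it goes back to vouch for
   its previous target, and then probes the new one by bouncing [K] times before
   it passes it, where [K] is about [Delta p delta].  An agent of copy [c] acts
   only at nodes it trusts: [h], the vouched nodes, and the passed nodes u_i with
   i = c modulo 2.  A node that it never trusts is a black hole to it.

   As long as the hole x = u_k has not been passed, all reports name it.  If no
   explorer reports, both have been killed by x; the copy of parity k + 1 then
   trusts every node but x, so it locates x as [A] does.  The targets that the
   two explorers claimed last, if they are adjacent in the order, have different
   parities, so no copy ever trusts all nodes; hence each copy makes at most [m]
   moves, whatever the coins.  Finally, only the explorer that claimed x can pass
   it, after surviving at least [K] coins, which has probability at most
   (1 - p)^K <= delta, even against an adaptive adversary. *)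

(** * First visits of walks, and growing chains of sequences *)

Lemma first_visits_cons (V : eqType) (y : V) (w : seq V) :
  first_visits (y :: w) = y :: [seq z <- first_visits w | z != y].
Proof.
by rewrite /first_visits rev_cons undup_rcons rev_rcons filter_rev.
Qed.

Section Chains.
Variables (T : Type) (l : nat -> seq T).
Hypothesis l_step : forall j, exists s, l j.+1 = l j ++ s.

Lemma chain_prefix i j : i <= j -> exists s, l j = l i ++ s.
Proof.
elim: j => [|j IH]; first by rewrite leqn0 => /eqP->; exists [::];
  rewrite cats0.
rewrite leq_eqVlt => /orP[/eqP->|/IH[s sE]]; first by exists [::];
  rewrite cats0.
by have [s' s'E] := l_step j; exists (s ++ s'); rewrite s'E sE catA.
Qed.

(** Of two members of the chain one is a prefix of the other, so entry [n] is the same in all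
    members long enough to have it. This turns the growing finite schedules of a copy of [A] into
    one infinite schedule. *)
Lemma chain_limit : (forall n, exists j, n <= size (l j)) ->
  exists s : nat -> T, forall j, l j = mkseq s (size (l j)).
Proof.
move=> unb; have [j0 j0P] := unb 1; case l0: (l j0) j0P => [//|x0 l'] _.
have [f fP] := choice (fun n => unb n.+1).
exists (fun n => nth x0 (l (f n)) n) => j.
apply: (eq_from_nth (x0 := x0)); rewrite ?size_mkseq // => i lti;
  rewrite nth_mkseq //.
have [/chain_prefix[s ->]|/ltnW/chain_prefix[s ->]] := leqP j (f i).
  by rewrite nth_cat lti.
by rewrite nth_cat fP.
Qed.

End Chains.

(** * Scripts of the explorers *)

Variant instr (V : Type) := Go of V | Own | Vouch | Pass.
Arguments Own {V}.
Arguments Vouch {V}.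
Arguments Pass {V}.

Variant stage := Walking | Arrived | Owning | Probing of nat.

(* The number [cleared] of passed targets is also the index of the current one.
   In stage [Probing k] the explorer has to survive at least [k] more moves into
   or out of this target before it passes it. *)
Record progress (V : Type) :=
  Progress { pos : V; cleared : nat; stage_of : stage }.

Section Scripts.
Variables (V : finType) (e : rel V) (h : V) (K : nat).
Implicit Types (ord : seq V) (st : progress V) (s : seq (instr V)).

Definition known ord i := h :: take i ord.

Definition advance ord st ins :=
  let: Progress p i ph := st in
  match ins with
  | Go w => Progress w i match ph with
      | Walking => if w \in known ord i then Walking else Arrived
      | Probing k =>
          Probing (if (p == nth h ord i) || (w == nth h ord i) then k.-1 else k)
      | _ => ph
      end
  | Own => Progress p i Owning
  | Vouch => Progress p i (Probing K)
  | Pass => Progress p i.+1 Walking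
  end.

(** On arriving at a new target an explorer has to claim it before moving on. The last target of the
    order is never claimed: once all others are passed, it is found by elimination. In [Vouch] the
    shifted index denotes the previous target, or [h] before the first one is passed. *)
Definition valid ord st ins :=
  let: Progress p i ph := st in
  match ins, ph with
  | Go w, Walking => [&& e p w, p \in known ord i & w \in known ord i.+1]
  | Go w, Arrived => false
  | Go w, _ => [&& e p w, p \in known ord i.+1 & w \in known ord i.+1]
  | Own, Arrived => (p == nth h ord i) && (i < (size ord).-1)
  | Vouch, Owning => p == nth h (h :: ord) i
  | Pass, Probing 0 => p == nth h ord i
  | _, _ => false
  end.

Fixpoint follows ord st s :=
  if s is ins :: s' then valid ord st ins && follows ord (advance ord st ins) s'
  else if stage_of st is Walking then cleared st == (size ord).-1 else false.

Definition well_placed ord st :=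
  let: Progress p i ph := st in
  match ph with
  | Walking => (p \in known ord i) && (i <= (size ord).-1)
  | Arrived => (p == nth h ord i) && (i <= (size ord).-1)
  | _ => (p \in known ord i.+1) && (i < (size ord).-1)
  end.

Lemma known_next ord i w : w \in known ord i.+1 ->
  w \in known ord i \/ w = nth h ord i.
Proof.
have [lti|gei] := ltnP i (size ord); last first.
  by rewrite /known !take_oversize //; [left | apply: leqW].
rewrite /known (take_nth h lti) -rcons_cons mem_rcons in_cons.
by case/orP=> [/eqP|]; [right | left].
Qed.

Lemma known_sub ord i j : i <= j -> {subset known ord i <= known ord j}.
Proof.
move=> leij w; rewrite /known !in_cons => /orP[->//|].
by rewrite -(subnK leij) addnC takeD mem_cat => ->; rewrite orbT.
Qed.

Lemma nth_known ord i : i < size ord -> nth h ord i \in known ord i.+1.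
Proof. by move=> lti; rewrite /known (take_nth h lti)
  in_cons mem_rcons mem_head orbT. Qed.

Lemma well_placed_next ord st ins :
  well_placed ord st -> valid ord st ins -> well_placed ord (advance ord st
    ins).
Proof.
case: st => p i [|||k]; case: ins => [w|||] //=.
- move=> /andP[_ lei] /and3P[_ _ kw]; case: ifPn => [//|nkw].
  by have [kw'|->] := known_next kw; [rewrite kw' in nkw | rewrite /= eqxx].
- by move=> /andP[/eqP-> _] /andP[_ lti]; rewrite lti nth_known //; lia.
- by move=> /andP[_ lti] /and3P[_ _ kw]; rewrite kw lti.
- by move=> /andP[_ lti] /and3P[_ _ kw]; rewrite kw lti.
Qed.

Lemma follows_own ord i p q s w :
  path e p w -> p \in known ord i.+1 -> {subset w <= known ord i.+1} ->
  last p w = q -> follows ord (Progress q i Owning) s ->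
  follows ord (Progress p i Owning) (map (@Go V) w ++ s).
Proof.
elim: w p => [|y w IH] p /=; first by move=> _ _ _ ->.
move=> /andP[epy pw] kp kw lw fs; have ky : y \in known ord i.+1.
  by apply: kw; rewrite mem_head.
rewrite epy kp ky /=; apply: (IH y) => // z zw.
by apply: kw; rewrite in_cons zw orbT.
Qed.

(** The walk may touch the target and so use up some of the [k] moves; hence the continuation is
    required for every smaller count. *)
Lemma follows_probe ord i p q s w k :
  path e p w -> p \in known ord i.+1 -> {subset w <= known ord i.+1} ->
  last p w = q ->
  (forall k', k' <= k -> follows ord (Progress q i (Probing k')) s) ->
  follows ord (Progress p i (Probing k)) (map (@Go V) w ++ s).
Proof.
elim: w p k => [|y w IH] p k /=; first by move=> _ _ _ -> ->.
move=> /andP[epy pw] kp kw lw fs; have ky : y \in known ord i.+1.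
  by apply: kw; rewrite mem_head.
rewrite epy kp ky /=; apply: (IH y) => // [z zw|k' le'].
  by apply: kw; rewrite in_cons zw orbT.
by apply: fs; apply: (leq_trans le'); case: ifP => // _; lia.
Qed.

(** Both moves of a round touch the target, so [n] rounds account for [n.*2] coins. *)
Lemma follows_bounce ord i y s k n :
  e y (nth h ord i) -> e (nth h ord i) y -> y \in known ord i.+1 ->
  nth h ord i \in known ord i.+1 -> k <= n.*2 ->
  follows ord (Progress (nth h ord i) i (Probing 0)) s ->
  follows ord (Progress (nth h ord i) i (Probing k))
    (flatten (nseq n [:: Go y; Go (nth h ord i)]) ++ s).
Proof.
move=> e1 e2 ky kt; elim: n k => [|n IH] k /=; first by rewrite leqn0 => /eqP->.
move=> lek fs; rewrite e1 e2 ky kt eqxx orbT /=; apply: IH => //; lia.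
Qed.

(* [acc] is the part of the walk since the last target, which is walked three
   times in all: onto the next target, back, and onto the next target again. *)
Lemma script_exists ord (symE : symmetric e) w i p acc :
  uniq (h :: ord) -> i < size ord -> p = nth h (h :: ord) i ->
  path e p acc -> {subset acc <= known ord i} -> path e (last p acc) w ->
  [seq z <- first_visits w | z \notin known ord i] = drop i ord ->
  exists2 s, follows ord (Progress (last p acc) i Walking) s &
    size s <= 2 * size acc + 3 * size w + (2 * K + 3) * (size ord - i).
Proof.
move=> Uo; elim: w i p acc => [|y w IH] i p acc lti pE pacc kacc pw fv.
  by have := congr1 size fv; rewrite size_drop /=; lia.
have kp : p \in known ord i.
  rewrite pE; case: (i) lti => [|j] lti /=; first exact: mem_head.
  by apply: nth_known; lia.
set q := last p acc.
have kq : q \in known ord i.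
  rewrite /q; have := mem_last p acc; rewrite in_cons => /orP[/eqP->//|].
  exact: kacc.
(* With only the last target left the script is over: this target is deduced, not visited. *)
have [iE|neqi] := eqVneq i (size ord).-1.
  by exists [::] => //=; rewrite iE eqxx.
move: pw fv; rewrite /= first_visits_cons /= => /andP[eqy pw].
have [ky|nky] /= := boolP (y \in known ord i).
  move=> fv; have [||||||s fs les] // := IH i p (rcons acc y).
  - by rewrite rcons_path pacc.
  - by move=> z; rewrite mem_rcons in_cons => /orP[/eqP->//|/kacc].
  - by rewrite last_rcons.
  - rewrite -fv -filter_predI; apply: eq_filter => z /=.
    by case: eqVneq => [->|]; rewrite ?ky ?andbT.
  exists (Go y :: s).
    rewrite last_rcons in fs.
    by rewrite /= eqy kq (known_sub _ ky) //= ky.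
  by move: les; rewrite size_rcons /=; clear; lia.
rewrite (drop_nth h lti) => -[yE fv].
have [||||||s fs les] // := IH i.+1 y [::].
- by lia.
- rewrite -fv -filter_predI; apply: eq_filter => z /=.
  by rewrite /known (take_nth h lti) !in_cons mem_rcons in_cons -yE;
    case: (z == y); rewrite ?andbT ?andbF ?orbT //= ?orbF.
have ky1 : y \in known ord i.+1 by rewrite yE nth_known.
have subK := @known_sub ord i i.+1 (leqnSn i).
pose seg := rcons acc y.
have pseg : path e p seg by rewrite rcons_path pacc.
have kseg : {subset seg <= known ord i.+1}.
  by move=> z; rewrite mem_rcons in_cons => /orP[/eqP->//|/kacc/subK].
have lseg : last p seg = y by rewrite last_rcons.
(* Step onto [y] and claim it, walk back along [acc] to the previous target [p], vouch for [p],
   return to [y], bounce [K] times between [y] and [q], pass [y]. Each edge of the walk is thus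
   counted three times, and each target costs [2 * K] moves and three marks. *)
exists (Go y :: Own :: map (@Go V) (rev (belast p seg)) ++
  Vouch :: map (@Go V) seg ++
  flatten (nseq K [:: Go q; Go y]) ++ Pass :: s); last first.
  rewrite /= size_cat /= size_cat size_map size_cat size_map size_rev.
  rewrite size_belast /seg size_rcons size_flatten /shape map_nseq sumn_nseq /=.
  move: les => /=; rewrite -(subnSK lti) [(2 * K + 3) * _.+1]mulnS.
  by move: ((2 * K + 3) * _) => n; clear; lia.
have lt1 : i < (size ord).-1 by move: neqi lti; clear; lia.
rewrite /= eqy kq ky1 (negbTE nky) yE eqxx lt1 /=.
apply: (follows_own (q := p)) => //.
- rewrite -yE -lseg rev_path.
  by rewrite (eq_path (e' := e)) // => a b; rewrite symE.
- by rewrite -yE.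
- by move=> z; rewrite mem_rev /seg belast_rcons in_cons => /orP[/eqP->|/kacc];
    apply: subK.
- by rewrite /seg belast_rcons rev_cons last_rcons.
rewrite /= pE eqxx /= -pE.
apply: (follows_probe (q := y)) => // [|k lek]; first exact: subK.
rewrite -yE {1 2}yE; apply: follows_bounce; rewrite -?yE //.
- by rewrite symE.
- exact: subK.
- by move: lek; clear; lia.
by rewrite /= yE eqxx -yE.
Qed.

End Scripts.

(** * The protocol *)

Variant memory_state (V M : Type) (n : nat) :=
| Fresh
| Forth of bool & 'I_n
| Retreat of bool & 'I_n & V
| Copy of bool & M.
Arguments Fresh {V M n}.
Arguments Forth {V M n}.
Arguments Retreat {V M n}.
Arguments Copy {V M n}.

Section MemoryFinite.
Variables (V M : finType) (n : nat).

Definition memory_code (s : memory_state V M n) :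
    unit + bool * 'I_n + bool * 'I_n * V + bool * M :=
  match s with
  | Fresh => inl (inl (inl tt))
  | Forth d k => inl (inl (inr (d, k)))
  | Retreat d k w => inl (inr (d, k, w))
  | Copy c m => inr (c, m)
  end.

Definition memory_decode c : memory_state V M n :=
  match c with
  | inl (inl (inl tt)) => Fresh
  | inl (inl (inr (d, k))) => Forth d k
  | inl (inr (d, k, w)) => Retreat d k w
  | inr (c, m) => Copy c m
  end.

Lemma memory_codeK : cancel memory_code memory_decode.
Proof. by case. Qed.

HB.instance Definition _ :=
  Finite.copy (memory_state V M n) (can_type memory_codeK).

End MemoryFinite.

(* The [k] agents that have started at [h] are counted by
   [started = (1 < k, odd k)], which is all that is needed to assign roles. *)
Record whiteboard (B : Type) := Whiteboard {
  started : bool * bool;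
  owner : option bool;
  passed : bool;
  vouched : bool;
  sheets : {ffun bool -> B}
}.

Section Whiteboards.
Variable B : finType.
Implicit Type b : whiteboard B.

Definition board_code b := (started b, owner b, passed b, vouched b, sheets b).

Definition board_decode c : whiteboard B :=
  let: (k, o, p, v, s) := c in Whiteboard k o p v s.

Lemma board_codeK : cancel board_code board_decode.
Proof. by case. Qed.

HB.instance Definition _ := Finite.copy (whiteboard B) (can_type board_codeK).

(** The factor [48 = 4 * 3 * 2 * 2] counts the values of the four marks, and the square the two
    sheets; so whiteboards of logarithmic size remain logarithmic. *)
Lemma card_whiteboard : #|{: whiteboard B}| <= 48 * #|B| ^ 2.
Proof.
have := leq_card board_code (can_inj board_codeK).
by rewrite !card_prod card_option card_ffun card_bool.
Qed.

Definition set_started b n := Whiteboard n (owner b) (passed b) (vouched b)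
  (sheets b).
Definition set_owner b d :=
  Whiteboard (started b) (Some d) (passed b) (vouched b) (sheets b).
Definition set_passed b := Whiteboard (started b) (owner b) true (vouched b)
  (sheets b).
Definition set_vouched b := Whiteboard (started b) (owner b) (passed b)
  true (sheets b).
Definition set_sheet b (c : bool) s :=
  Whiteboard (started b) (owner b) (passed b) (vouched b)
    [ffun c' => if c' == c then s else sheets b c'].

End Whiteboards.

(* What the two explorers agree on: the nodes other than [h] in the order of the
   traversal pair, followed by explorer [false] from its first and by explorer
   [true] from its last node, the length of a probe, and the two scripts. *)
Record plan (V : finType) (e : rel V) (h : V) := Plan {
  targets : seq V;
  rounds : nat;
  script : bool -> seq (instr V);
  plan_sym : symmetric e;
  plan_uniq : uniq (h :: targets);
  plan_all : forall u, u != h -> u \in targets;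
  plan_gt0 : 0 < size targets;
  plan_follows : forall d : bool,
    follows e h rounds (if d then rev targets else targets)
      (Progress h 0 Walking) (script d)
}.

Section Search.
Variables (V : finType) (e : rel V) (h : V) (G : plan e h) (A : protocol V).

Local Notation us := (targets G).
Local Notation K := (rounds G).
Local Notation scr := (script G).

Definition ords (d : bool) := if d then rev us else us.
Definition idx d u := index u (ords d).

Definition prog d k :=
  foldl (advance h K (ords d)) (Progress h 0 Walking) (take k (scr d)).

Definition maxlen := (size (scr false) + size (scr true)).+1.

Local Notation mem_t := (memory_state V (memory A) maxlen).
Local Notation wb_t := (whiteboard (board A)).

(** For both explorers the parity is that of the position in [us], so a target that is passed but
    not vouched is trusted by exactly one copy. *)
Definition trusted (c : bool) w (b : wb_t) :=
  [|| w == h, vouched b | passed b && (odd (index w us) == c)].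

(** The first two agents to act become the explorers [false] and [true], the later ones join the two
    copies alternately. A retreating explorer replays the positions of its script backwards, which
    takes only a counter. *)
Definition search_program (v : V) (s : mem_t) (b : wb_t) :
    mem_t * wb_t * action V :=
  match s with
  | Fresh =>
      let: (many, parity) := started b in
      (if many then Copy parity (memory0 A) else Forth parity ord0,
       set_started b (many || parity, ~~ parity), Stay)
  | Forth d k =>
      let s' := Forth d (inord k.+1) in
      match drop k (scr d) with
      | [::] => (Retreat d k (nth h (ords d) (size us).-1), b, Stay)
      | Go w :: _ => (s', b, Move w)
      | Own :: _ => if owner b == Some (~~ d) then (Retreat d k v, b, Stay)
                    else (s', set_owner b d, Stay)
      | Pass :: _ => (s', set_passed b, Stay)
      | Vouch :: _ => (s', set_vouched b, Stay)
      end
  | Retreat d k w =>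
      if k == 0 :> nat then (s, b, Report w)
      else (Retreat d (inord k.-1) w, b, Move (pos (prog d k.-1)))
  | Copy c m =>
      if trusted c v b then
        let: (m', b', ac) := program v m (sheets b c) in
        (Copy c m', set_sheet b c b', ac)
      else (s, b, Stay)
  end.

Definition search_protocol : protocol V :=
  @Protocol V (nagents A).*2.+2 isT _ _ Fresh
    (Whiteboard (false, false) None false false [ffun=> board0 A])
    search_program.

Local Notation Ar := search_protocol.
Local Notation agent := 'I_(nagents Ar).

Lemma lt_maxlen d k : k <= size (scr d) -> k < maxlen.
Proof. by rewrite /maxlen; case: d; lia. Qed.

Lemma size_ords d : size (ords d) = size us.
Proof. by case: d; rewrite /= ?size_rev. Qed.

Lemma mem_ords d : ords d =i us.
Proof. by case: d => u; rewrite /= ?mem_rev. Qed.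

Lemma uniq_ords d : uniq (h :: ords d).
Proof. by move: (plan_uniq G); rewrite /= mem_ords; case: d;
  rewrite /= ?rev_uniq. Qed.

Lemma idx_lt d u : u \in us -> idx d u < size us.
Proof. by rewrite -(size_ords d) index_mem mem_ords. Qed.

Lemma nth_idx d u : u \in us -> nth h (ords d) (idx d u) = u.
Proof. by move=> uu; rewrite nth_index // mem_ords. Qed.

Lemma idx_nth d i : i < size us -> idx d (nth h (ords d) i) = i.
Proof.
by move=> lti; rewrite /idx index_uniq ?size_ords //; case/andP: (uniq_ords d).
Qed.

Lemma idx_eq d u i : u \in us -> i < size us ->
  (idx d u == i) = (u == nth h (ords d) i).
Proof.
move=> uu lti; apply/eqP/eqP => [<-|->]; first by rewrite nth_idx.
by rewrite idx_nth.
Qed.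

Lemma idx_opp d u : u \in us -> idx d u + idx (~~ d) u = (size us).-1.
Proof.
move=> uu; wlog -> : d / d = false.
  by case: d => [W|->//]; rewrite addnC W.
have lt1 := idx_lt false uu; have lt2 := idx_lt true uu; have us0 := plan_gt0 G.
have := nth_idx true uu; rewrite /= nth_rev // => uE.
have := idx_nth false (i := size us - (idx true u).+1); rewrite uE => ->; lia.
Qed.

Lemma known_idx d i u : u \in us -> (u \in known h (ords d) i) = (idx d u < i).
Proof.
move=> uu; have neq : u != h by apply: contraTneq uu => ->;
  case/andP: (plan_uniq G).
by rewrite in_cons (negPf neq) in_take // mem_ords.
Qed.

(** * The invariant *)

Definition is_open (st : progress V) :=
  match stage_of st with Walking | Arrived => true | _ => false end.
Definition owned (st : progress V) := cleared st + ~~ is_open st.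
(** Vouching lags behind passing: the last passed target is vouched only after the next one has been
    claimed, and this opens stage [Probing]. *)
Definition vouches (st : progress V) :=
  if stage_of st is Probing _ then cleared st else (cleared st).-1.

Lemma prog_follows d k :
  follows e h K (ords d) (prog d k) (drop k (scr d)) /\
  well_placed h (ords d) (prog d k).
Proof.
have : follows e h K (ords d) (Progress h 0 Walking) (scr d) /\
    well_placed h (ords d) (Progress h 0 Walking).
  by split; [exact: plan_follows | rewrite /= mem_head].
rewrite /prog; move: (Progress _ _ _); elim: (scr d) k =>
  [|ins s IH] [|k] st //=.
case=> /andP[v fs] wp; apply: IH; split=> //; exact: well_placed_next wp v.
Qed.

Lemma progS d k ins r : drop k (scr d) = ins :: r ->
  [/\ prog d k.+1 = advance h K (ords d) (prog d k) ins,
      k < size (scr d) & valid e h (ords d) (prog d k) ins].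
Proof.
move=> dE; have ltk : k < size (scr d).
  by rewrite ltnNge; apply/negP => /drop_oversize; rewrite dE.
have := prog_follows d k; rewrite dE /= => -[/andP[v _] _]; split=> //.
rewrite /prog (take_nth ins ltk) foldl_rcons.
by move: dE; rewrite (drop_nth ins ltk) => -[-> _].
Qed.

Lemma prog0 d : prog d 0 = Progress h 0 Walking.
Proof. by rewrite /prog take0. Qed.

Lemma prog_stop d k : drop k (scr d) = [::] ->
  stage_of (prog d k) = Walking /\ cleared (prog d k) = (size us).-1.
Proof.
move=> dE; have [+ _] := prog_follows d k; rewrite dE /=.
by case: (stage_of _) => // /eqP; rewrite size_ords.
Qed.

Lemma prog_cases d k : k < size (scr d) ->
  exists ins r, drop k (scr d) = ins :: r.
Proof.
case E: (drop k (scr d)) => [|ins r]; last by exists ins, r.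
by have := congr1 size E; rewrite size_drop /=; lia.
Qed.

Lemma cleared_mono d k l : k <= l -> l <= size (scr d) ->
  cleared (prog d k) <= cleared (prog d l).
Proof.
elim: l => [|l IH]; first by rewrite leqn0 => /eqP->.
rewrite leq_eqVlt => /orP[/eqP->//|lekl] ltl; apply:
  leq_trans (IH _ (ltnW ltl)) _ => //.
have [ins [r dE]] := prog_cases ltl; have [-> _ _] := progS dE.
by case: (prog d l) => p i ph; case: ins {dE} => //=; lia.
Qed.

(** Earlier positions [k] are included in order to confine the hole when an explorer is killed while
    retreating. *)
Lemma prog_known d k l : k <= l -> l <= size (scr d) ->
  pos (prog d k) \in known h (ords d) (cleared (prog d l)).+1.
Proof.
move=> lekl lel; have lec := cleared_mono lekl lel.
suff: pos (prog d k) \in known h (ords d) (cleared (prog d k)).+1.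
  exact: (known_sub (i := (cleared (prog d k)).+1)).
have [_] := prog_follows d k; case: (prog d k) => p i [|||m] /=.
- by case/andP=> + _; apply: (known_sub (i := i)).
- case/andP=> /eqP-> lei; apply: nth_known; rewrite size_ords in lei *;
    have := plan_gt0 G; lia.
- by case/andP.
- by case/andP.
Qed.

Lemma cleared_le d k : owned (prog d k) <= (size us).-1.
Proof.
have [_] := prog_follows d k; rewrite -(size_ords d).
by case: (prog d k) => p i [|||m] /= /andP[_]; rewrite /owned /=; lia.
Qed.

Variable x : V.

Local Notation state_t := (agent_state V mem_t).
Local Notation stepx := (step e h x).

Definition either (f : bool -> bool) := f false || f true.

Lemma eitherE f d : either f = f d || f (~~ d).
Proof. by case: d; rewrite /either // orbC. Qed.

Definition others_passed (cf : config Ar) w :=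
  forall u, u \in us -> u != w -> passed (boards cf u).

Definition explorer_state d p (cf : config Ar) (st : state_t) : Prop :=
  match st with
  | At w (Forth d' k) => [/\ d' = d, k = p :> nat & w = pos (prog d p)]
  | InTransit u w (Forth d' k) =>
      [/\ d' = d, k = p.+1 :> nat, u = pos (prog d p) &
          exists r, drop p (scr d) = Go w :: r]
  | At w (Retreat d' k t) =>
      [/\ d' = d, k <= p, w = pos (prog d k), is_open (prog d p) &
          others_passed cf t]
  | InTransit u w (Retreat d' k t) =>
      [/\ d' = d, k < p, w = pos (prog d k), u = pos (prog d k.+1) &
          is_open (prog d p) /\ others_passed cf t]
  | Killed => x \in known h (ords d) (cleared (prog d p)).+1
  | Reported t => others_passed cf t
  | _ => False
  end.

Definition copy_state c (st : state_t) : Prop :=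
  match st with
  | At _ s | InTransit _ _ s => exists m, s = Copy c m
  | _ => True
  end.

(** As [owner] holds a single value, the first clause for both values of [d] makes the claims of the
    two explorers disjoint. *)
Definition marks (P : bool -> nat) (b : wb_t) u : Prop :=
  [/\ forall d, (owner b == Some d) = (idx d u < owned (prog d (P d))),
      passed b = either (fun d => idx d u < cleared (prog d (P d))) &
      vouched b = either (fun d => idx d u < vouches (prog d (P d)))].

(* [S] lists the agents in the order in which they started, and [P d] is the
   number of instructions that explorer [d] carried out before it was killed or
   began to retreat, if it did. *)
Record coherent (S : seq agent) (P : bool -> nat) (cf : config Ar) : Prop :=
  Coherent {
  coherent_uniq : uniq S;
  coherent_started : started (boards cf h) = (1 < size S, odd (size S));
  coherent_fresh : forall b, b \notin S -> agents cf b = At h Fresh;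
  coherent_copy : forall b, b \in S -> 1 < index b S ->
    copy_state (odd (index b S)) (agents cf b);
  coherent_explorer : forall (d : bool) b, b \in S -> index b S = d ->
    explorer_state d (P d) cf (agents cf b);
  coherent_frozen : forall d : bool, size S <= d -> P d = 0;
  coherent_size : forall d, P d <= size (scr d);
  coherent_marks : forall u, u \in us -> marks P (boards cf u) u
}.

Lemma coherent0 : coherent [::] (fun=> 0) (config0 h Ar).
Proof.
split=> //= [|b|u uu]; rewrite ?ffunE //.
by split=> [d||]; rewrite /either !prog0.
Qed.

Lemma explorer_state_mono d p (cf cf' : config Ar) st :
  (forall u, passed (boards cf u) -> passed (boards cf' u)) ->
  explorer_state d p cf st -> explorer_state d p cf' st.
Proof.
move=> mono; have monoO w : others_passed cf w -> others_passed cf' w.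
  by move=> ow u uu uw; apply/mono/ow.
case: st => [w [|d' k|d' k t|c m]|u w [|d' k|d' k t|c m]||t] //=.
- by case=> *; split=> //; apply: monoO.
- by case=> ? ? ? ? [? ?]; split=> //; split=> //; apply: monoO.
- exact: monoO.
Qed.

(** Frame lemma for a step of an agent that has started: no other agent changes its state, and at
    most its own progress changes. *)
Lemma coherent_update S P P' (cf cf' : config Ar) b st : coherent S P cf ->
  b \in S ->
  agents cf' = set_agent cf b st ->
  started (boards cf' h) = started (boards cf h) ->
  (forall u, passed (boards cf u) -> passed (boards cf' u)) ->
  (forall u, u \in us -> marks P' (boards cf' u) u) ->
  (forall d : bool, index b S <> d -> P' d = P d) ->
  (forall d, P' d <= size (scr d)) ->
  (1 < index b S -> copy_state (odd (index b S)) st) ->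
  (forall d : bool, index b S = d -> explorer_state d (P' d) cf' st) ->
  coherent S P' cf'.
Proof.
move=> [Su Ss Sf Sc Se Sz Sl Sm] bS aE sE mono Sm' P'E Sl' cs es; split=> //.
- by rewrite sE.
- move=> b' nb'; rewrite aE ffunE ifN ?Sf //.
  by apply: contraNneq nb' => ->.
- move=> b' b'S lt1; rewrite aE ffunE; case: eqVneq => [E|_]; last exact: Sc.
  by rewrite E in lt1 *; apply: cs.
- move=> d b' b'S iE; rewrite aE ffunE; case: eqVneq => [E|nE].
    by rewrite E in iE; apply: es.
  rewrite P'E; first by apply: explorer_state_mono mono _; apply: Se.
  move=> iE'; have := nth_index b b'S; rewrite iE -iE' nth_index // => bE.
  by rewrite bE eqxx in nE.
- move=> d lt; rewrite P'E; first exact: Sz.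
  by move=> iE; move: lt; rewrite -iE leqNgt index_mem bS.
Qed.

Lemma notin_h u : u \in us -> (u == h) = false.
Proof. by move=> uu; apply: contraTF uu => /eqP->;
  case/andP: (plan_uniq G). Qed.

Definition bump_at (P : bool -> nat) (d : bool) : bool -> nat :=
  fun d' => if d' == d then (P d).+1 else P d'.

Definition board_after d (ins : instr V) (b : wb_t) :=
  match ins with
  | Go _ => b
  | Own => set_owner b d
  | Pass => set_passed b
  | Vouch => set_vouched b
  end.

(** [Own], [Pass] and [Vouch] each raise one of the counts [owned], [cleared] and [vouches], and the
    index newly covered is that of the current node; [Go] changes none of them. *)
Lemma marks_advance S P cf d ins r : coherent S P cf ->
  drop (P d) (scr d) = ins :: r ->
  (if ins is Own then owner (boards cf (pos (prog d (P d)))) <> Some (~~ d)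
   else True) ->
  forall u, u \in us -> marks (bump_at P d)
    (if u == pos (prog d (P d)) then board_after d ins (boards cf u)
     else boards cf u) u.
Proof.
move=> I dE own u uu; have [mo mp mv] := coherent_marks I uu.
have [pE ltp vi] := progS dE.
have [_ wp] := prog_follows d (P d).
have PdE : bump_at P d d = (P d).+1 by rewrite /bump_at eqxx.
have PndE : bump_at P d (~~ d) = P (~~ d) by rewrite /bump_at; case: (d).
have mo1 := mo d; have mo2 := mo (~~ d).
move: mp mv; rewrite !(eitherE _ d) => mp mv.
suff : let b := if u == pos (prog d (P d))
      then board_after d ins (boards cf u) else boards cf u in
    [/\ (owner b == Some d) = (idx d u < owned (prog d (P d).+1)),
        (owner b == Some (~~ d)) = (idx (~~ d) u < owned (prog (~~ d)
          (P (~~ d)))),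
        passed b = (idx d u < cleared (prog d (P d).+1)) ||
                   (idx (~~ d) u < cleared (prog (~~ d) (P (~~ d)))) &
        vouched b = (idx d u < vouches (prog d (P d).+1)) ||
                   (idx (~~ d) u < vouches (prog (~~ d) (P (~~ d))))].
  case=> o1 o2 p2 v2; split; rewrite ?(eitherE _ d) ?PdE ?PndE //.
  move=> d'; have [->|nd] := eqVneq d' d; first by rewrite PdE.
  by have -> : d' = ~~ d; [case: (d') (d) nd => -[] | rewrite PndE].
rewrite /= pE; move: vi wp own mo1 mo2 mp mv; clear mo PdE PndE dE I ltp pE.
have sz := size_ords d.
case: (prog d (P d)) => p i ph /=; rewrite /owned /vouches /is_open.
case: ins => [w|||] /=.
- move=> _ _ _ o1 o2 p1 v1; rewrite if_same o1 o2 p1 v1.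
  by split=> //; case: (ph) => //=; case: ifP.
- case: ph => //= /andP[/eqP-> lti] _ nown o1 o2 p1 v1.
  have iE : (idx d u == i) = (u == nth h (ords d) i) by apply: idx_eq => //;
    lia.
  rewrite addn0 in o1; rewrite addn1 -iE.
  case: (eqVneq (idx d u) i) => [iE'|nE] /=.
    split=> //; first by rewrite iE' ltnSn eqxx.
    have /eqP uE : u == nth h (ords d) i by rewrite -iE iE'.
    by rewrite -o2 uE; move/eqP/negPf: nown => ->; case: (d).
  by have ltE : (idx d u < i.+1) = (idx d u < i) by [lia]; rewrite ltE; split.
- case: ph => //= /eqP-> /andP[_ lti] _ o1 o2 p1 v1.
  (* Before anything is passed the explorer vouches at [h], which is no target, and the count stays
     0. *)
  case: i lti o1 p1 v1 => [|i] lti o1 p1 v1; first by rewrite notin_h.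
  have iE : (idx d u == i) = (u == nth h (ords d) i) by apply: idx_eq => //;
    lia.
  rewrite /= -iE; case: (eqVneq (idx d u) i) => [iE'|nE] /=; split=> //.
    by rewrite iE' ltnSn.
  by have ltE : (idx d u < i.+1) = (idx d u < i) by [lia]; rewrite ltE.
- case: ph => // -[] //= /eqP-> /andP[_ lti] _ o1 o2 p1 v1.
  have iE : (idx d u == i) = (u == nth h (ords d) i) by apply: idx_eq => //;
    lia.
  rewrite addn1 in o1; rewrite addn0 -iE.
  case: (eqVneq (idx d u) i) => [iE'|nE] /=; split=> //;
    first by rewrite iE' ltnSn.
  by have ltE : (idx d u < i.+1) = (idx d u < i) by [lia]; rewrite ltE.
Qed.

End Search.

(** * Preservation of the invariant by a step *)

Section Runs.
Variables (V : finType) (e : rel V) (h : V) (G : plan e h) (A : protocol V).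

Local Notation us := (targets G).
Local Notation K := (rounds G).
Local Notation scr := (script G).
Local Notation Ar := (search_protocol G A).
Local Notation agent := 'I_(nagents Ar).
Variable x : V.
Local Notation stepx := (step e h x).
Implicit Types (cf : config Ar) (S : seq agent) (P : bool -> nat) (b : agent).
Implicit Types (d c : bool) (u w z : V).

Lemma eqb_nat (a1 a2 : bool) : (nat_of_bool a1 == a2) = (a1 == a2).
Proof. by case: a1; case: a2. Qed.

Definition enlist (S : seq agent) b := if b \in S then S else rcons S b.

(** Here [cf] is the configuration after the step. An explorer standing on its way forth shows its
    progress in its counter; in transit, in retreat, killed or done, it keeps the old value. *)
Definition new_progress (S : seq agent) P b (cf : config Ar) (d : bool) : nat :=
  if (b \in S) && (index b S == d :> nat) then
    if agents cf b is At _ (Forth _ k) then k else P d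
  else P d.

Lemma step_at (cf : config Ar) b v (s : memory Ar) kill :
  agents cf b = At v s ->
  stepx b kill cf =
  let: (s', b', ac) := search_program v s (boards cf v) in
  Config (P := Ar) (set_agent cf b (act (P := Ar) e h v s' ac))
    [ffun w => if w == v then b' else boards cf w] (moves cf).
Proof. by rewrite /step => ->. Qed.

Lemma agents_other cf b b' kill : b' != b ->
  agents (stepx b kill cf) b' = agents cf b'.
Proof.
move=> nb; case stE: (agents cf b) => [v s|u v s||t].
- rewrite (step_at _ stE); case: (search_program v s _) => [[s' b''] ac] /=.
  by rewrite ffunE (negPf nb).
- by rewrite /step stE /= ffunE (negPf nb).
- by rewrite /step stE.
- by rewrite /step stE.
Qed.

Lemma others_passed_stop S P cf d : coherent x S P cf ->
  drop (P d) (scr d) = [::] ->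
  is_open (prog G d (P d)) /\ others_passed cf (nth h (ords G d) (size us).-1).
Proof.
move=> I dE; have [sE cE] := prog_stop dE.
split=> [|u uu nu]; first by rewrite /is_open sE.
have [_ -> _] := coherent_marks I uu; rewrite (eitherE _ d) cE; apply/orP; left.
rewrite -idx_eq // in nu; last by have := plan_gt0 G; lia.
by have := idx_lt d uu; lia.
Qed.

(** This explorer has passed all targets before the current one. The other has claimed the current
    one, and it claims at most one target beyond those it has passed, so it has passed all the later
    ones. *)
Lemma others_passed_meet S P cf d r : coherent x S P cf ->
  drop (P d) (scr d) = Own :: r ->
  owner (boards cf (pos (prog G d (P d)))) = Some (~~ d) ->
  is_open (prog G d (P d)) /\ others_passed cf (pos (prog G d (P d))).
Proof.
move=> I dE; have [_ _] := progS dE; rewrite /is_open.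
case PE: (prog G d (P d)) => [p i []] //= /andP[/eqP-> lti] own;
  split=> // u uu nu.
rewrite size_ords in lti.
have pu : nth h (ords G d) i \in us by rewrite -(mem_ords G d)
  mem_nth // size_ords; lia.
have [/(_ (~~ d))] := coherent_marks I pu; rewrite own eqxx => /esym lto _ _.
have [_ -> _] := coherent_marks I uu; rewrite (eitherE _ d) PE /=.
have le1 : owned (prog G (~~ d) (P (~~ d))) <= (cleared (prog G (~~ d)
  (P (~~ d)))).+1.
  by rewrite /owned; case: is_open; lia.
rewrite -idx_eq // in nu; last by lia.
have := idx_opp d uu; have := idx_opp d pu; rewrite idx_nth //; last by lia.
lia.
Qed.

Lemma prog_retrace d k : k < size (scr d) ->
  e (pos (prog G d k.+1)) (pos (prog G d k)) \/
  pos (prog G d k.+1) = pos (prog G d k).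
Proof.
move=> /prog_cases[ins [r dE]]; have [-> _] := progS dE.
case: (prog G d k) => p i ph; case: ins dE => [w|||] _ /=; auto.
by rewrite (plan_sym G); case: ph => // [|| ?] /and3P[]; auto.
Qed.

Lemma coherent_fresh_step S P cf b kill : coherent x S P cf -> b \notin S ->
  coherent x (rcons S b) P (stepx b kill cf).
Proof.
move=> I nb; case: (I) => Su Ss Sf Sc Se Sz Sl Sm.
rewrite (step_at _ (Sf _ nb)) /= Ss; set m := (if _ then _ else _).
have idxE b' : b' \in S -> index b' (rcons S b) = index b' S.
  by move=> b'S; rewrite -cats1 index_cat b'S.
have idxb : index b (rcons S b) = size S.
  by rewrite -cats1 index_cat (negPf nb) /= eqxx addn0.
split=> /=.
- by rewrite rcons_uniq nb.
- rewrite ffunE eqxx /= size_rcons; congr (_, _).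
  by case: (size S) => [|[|n]].
- move=> b'; rewrite mem_rcons in_cons negb_or ffunE => /andP[/negPf-> nb'].
  exact: Sf.
- move=> b'; rewrite mem_rcons in_cons ffunE; case: eqVneq => [->|_] /= b'S.
    by rewrite idxb /m => ->; exists (memory0 A).
  by rewrite idxE // => lt1; apply: Sc.
- move=> d b'; rewrite mem_rcons in_cons ffunE; case: eqVneq => [->|_] /= b'S.
    rewrite idxb /m => sd; rewrite sd ltnNge leq_b1 /= oddb Sz ?sd //.
    by rewrite prog0.
  rewrite idxE // => /(Se _ _ b'S); apply: explorer_state_mono => u.
  by rewrite ffunE; case: eqVneq => [->|].
- by move=> d; rewrite size_rcons => lt; apply: Sz;
    apply: leq_trans (leqnSn _) lt.
- exact: Sl.
- by move=> u uu; rewrite ffunE (notin_h uu); apply: Sm.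
Qed.

Lemma coherent_explorer_step S P cf b kill d : coherent x S P cf ->
  b \in S -> index b S = d :> nat ->
  coherent x S (new_progress S P b (stepx b kill cf)) (stepx b kill cf).
Proof.
move=> I bS iE; have es := coherent_explorer I bS iE.
set cf' := stepx b kill cf; set P' := new_progress S P b cf'.
have ext bd st : agents cf' = set_agent cf b st -> boards cf' = bd ->
    started (bd h) = started (boards cf h) ->
    (forall u, passed (boards cf u) -> passed (bd u)) ->
    (forall u, u \in us -> marks G P' (bd u) u) ->
    P' d <= size (scr d) ->
    explorer_state x d (P' d) cf' st -> coherent x S P' cf'.
  move=> aE bE sE mono mk le' es'.
  have P'E (d' : bool) : index b S <> d' -> P' d' = P d'.
    by rewrite /P' /new_progress; case: eqP => // _; rewrite andbF.
  apply: (coherent_update I bS aE) => //; rewrite ?bE //.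
  - move=> d'; have [->//|nd] := eqVneq d' d.
    rewrite P'E ?(coherent_size I) //; rewrite iE => /eqP;
      rewrite eqb_nat => /eqP E.
    by rewrite E eqxx in nd.
  - by rewrite iE ltnNge leq_b1.
  - by move=> d'; rewrite iE => /eqP; rewrite eqb_nat => /eqP <-.
(* Steps that complete no instruction of the script. *)
have ext0 st : agents cf' = set_agent cf b st -> boards cf' = boards cf ->
    (if st is At _ (Forth _ k) then k = P d :> nat else True) ->
    explorer_state x d (P d) cf st -> coherent x S P' cf'.
  move=> aE bE fE es'.
  have PE : P' = P.
    apply/funext => d'; rewrite /P' /new_progress aE ffunE eqxx bS iE eqb_nat.
    by case: eqP => //= <-; case: (st) fE => [v []|u v s||t].
  apply: (ext _ st aE bE); rewrite ?PE //.
  - exact: coherent_marks I.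
  - exact: coherent_size I d.
  - by apply: explorer_state_mono es' => u; rewrite bE.
(* Steps that complete exactly one instruction. *)
have ext1 ins r w (k : 'I_(maxlen G)) : drop (P d) (scr d) = ins :: r ->
    agents cf' = set_agent cf b (At w (Forth d k)) ->
    k = (P d).+1 :> nat -> w = pos (prog G d (P d).+1) ->
    boards cf' = [ffun u => if u == pos (prog G d (P d))
      then board_after d ins (boards cf u) else boards cf u] ->
    (if ins is Own then owner (boards cf (pos (prog G d (P d)))) <> Some (~~ d)
     else True) -> coherent x S P' cf'.
  move=> dE aE kE wE bE own; have [_ ltP _] := progS dE.
  have PE : P' = bump_at P d.
    apply/funext => d'; rewrite /P' /new_progress /bump_at aE ffunE eqxx bS iE
      eqb_nat.
    by rewrite eq_sym; case: eqP => // ->.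
  apply: (ext _ _ aE bE).
  - by rewrite ffunE; case: ifP => // _; case: (ins).
  - by move=> u; rewrite ffunE; case: ifP => // _; case: (ins).
  - by move=> u uu; rewrite ffunE PE; apply: marks_advance I dE own _ uu.
  - by rewrite PE /bump_at eqxx.
  - by rewrite PE /bump_at eqxx /= kE wE.
move: es ext0 ext1; clear ext; rewrite {}/P' {}/cf'.
have ffid v : [ffun w => if w == v then boards cf v else boards cf w]
  = boards cf.
  by apply/ffunP => w; rewrite ffunE; case: eqVneq => [->|].
have boardsE ins v : v = pos (prog G d (P d)) ->
    [ffun w => if w == v then board_after d ins (boards cf v) else boards cf w]
    = [ffun u => if u == pos (prog G d (P d))
        then board_after d ins (boards cf u) else boards cf u].
  by move=> ->; apply/ffunP => w; rewrite !ffunE; case: eqVneq => [->|].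
have inordE k : k <= size (scr d) -> (inord k : 'I_(maxlen G)) = k :> nat /\
  k < maxlen G.
  by move=> /lt_maxlen ltk; split=> //; apply: inordK.
have leP := coherent_size I d.
case stE: (agents cf b) => [v s|u v s||t] /=; last 2 first.
- by move=> es ext0 _; apply: (ext0 Killed); rewrite /step ?stE //;
    apply/ffunP => b'; rewrite ffunE; case: eqP => [->|].
- move=> es ext0 _; apply: (ext0 (Reported t)); rewrite /step ?stE //;
    apply/ffunP => b'; rewrite ffunE; case: eqP => [->|] //.
- case: s stE => // [d' k|d' k t] stE.
    case=> dd kE vE; rewrite dd in stE; rewrite (step_at _ stE) /= kE.
    case dE: (drop (P d) (scr d)) => [|ins r].
      move=> ext0 _; apply: (ext0 (At v (Retreat d k (nth h (ords G d)
        (size us).-1)))) ; rewrite /= ?ffid //.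
      by have [op oth] := others_passed_stop I dE; split; rewrite ?kE.
    have [pE ltP vi] := progS dE; have [kE' _] := inordE _ ltP.
    case: ins dE pE vi => [w|||] dE pE vi ext0 ext1.
    + have evw : e v w.
        by move: vi; rewrite vE; case: (prog G d (P d)) =>
          p i [|||?] //= /and3P[].
      apply: (ext0 (InTransit v w (Forth d (inord (P d).+1)))) => //=;
        rewrite ?evw ?ffid //.
      by split=> //; exists r.
    + move: (boardsE Own _ vE) => bE; move: ext0 ext1.
      case: eqP => own ext0 ext1.
        apply: (ext0 (At v (Retreat d k v))) ; rewrite /= ?ffid //.
        rewrite vE in own *; have [op oth] := others_passed_meet I dE own.
        by split; rewrite ?kE.
      apply: (ext1 Own r v (inord (P d).+1)) => //=; rewrite -?vE //.
      by rewrite pE vE; case: (prog G d (P d)).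
    + apply: (ext1 Vouch r v (inord (P d).+1)) => //=.
        by rewrite pE vE; case: (prog G d (P d)).
      exact: (boardsE Vouch _ vE).
    + apply: (ext1 Pass r v (inord (P d).+1)) => //=.
        by rewrite pE vE; case: (prog G d (P d)).
      exact: (boardsE Pass _ vE).
  case=> dd lek vE op oth; rewrite dd in stE; rewrite (step_at _ stE) /=.
  case: eqP => [k0|nk0] ext0 ext1.
    have vh : v = h by rewrite vE k0 prog0.
    by apply: (ext0 (Reported t)) => //=; rewrite ?ffid ?vh ?eqxx.
  have kE : (inord k.-1 : 'I_(maxlen G)) = k.-1 :> nat by apply:
    (inordE _ _).1; lia.
  have SkE : k.-1.+1 = k by lia.
  have retr := @prog_retrace d k.-1; rewrite SkE -vE in retr.
  have [|evw|vw] := retr; first by lia.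
    apply: (ext0 (InTransit v (pos (prog G d k.-1)) (Retreat d (inord k.-1)
      t))); rewrite /= ?ffid ?evw //.
    by rewrite kE SkE; split=> //; lia.
  (* Retracing an instruction other than [Go] names the current node as destination. This is a move
     only if there is a loop; both outcomes are covered. *)
  have [evw|nev] := boolP (e v (pos (prog G d k.-1))).
    apply: (ext0 (InTransit v (pos (prog G d k.-1)) (Retreat d (inord k.-1)
      t))); rewrite /= ?ffid ?evw //.
    by rewrite kE SkE; split=> //; lia.
  apply: (ext0 (At v (Retreat d (inord k.-1) t)));
    rewrite /= ?ffid ?(negPf nev) //.
  by rewrite kE; split=> //; lia.
- case: s stE => // [d' k|d' k t] stE.
    case=> dd kE uE [r dE]; rewrite dd in stE; have [pE ltP vi] := progS dE;
      rewrite /step stE /=.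
    case: ifP => [/andP[ux _]|_] ext0 ext1.
      apply: (ext0 Killed) => //=.
      have := prog_known (leqnn _) leP; rewrite -uE.
      have kv : v \in known h (ords G d) (cleared (prog G d (P d))).+1.
        by move: vi; case: (prog G d (P d)) => p i [|||?] //= /and3P[].
      by case/orP: ux => /eqP <-.
    apply: (ext1 (Go v) r v k) => //=; first by rewrite pE;
      case: (prog G d (P d)).
    by apply/ffunP => w; rewrite ffunE if_same.
  case=> dd ltk vE uE [op oth]; rewrite dd in stE; rewrite /step stE /=.
  case: ifP => [/andP[ux _]|_] ext0 ext1.
    apply: (ext0 Killed) => //=.
    by case/orP: ux => /eqP <-; rewrite ?uE ?vE; apply: prog_known => //;
      apply: ltnW.
  by apply: (ext0 (At v (Retreat d k t))) => //=; split=> //; exact: ltnW.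
Qed.

Lemma coherent_copy_step S P cf b kill : coherent x S P cf ->
  b \in S -> 1 < index b S ->
  coherent x S (new_progress S P b (stepx b kill cf)) (stepx b kill cf).
Proof.
move=> I bS lt1; have cs := coherent_copy I bS lt1.
set cf' := stepx b kill cf.
have -> : new_progress S P b cf' = P.
  apply/funext => d; rewrite /new_progress; case: eqP => [iE|];
    last by rewrite andbF.
  by rewrite iE ltnNge leq_b1 in lt1.
have ext bd st : agents cf' = set_agent cf b st -> boards cf' = bd ->
    (forall u, [/\ started (bd u) = started (boards cf u),
       owner (bd u) = owner (boards cf u), passed (bd u) = passed (boards cf u)
         &
       vouched (bd u) = vouched (boards cf u)]) ->
    copy_state (odd (index b S)) st -> coherent x S P cf'.
  move=> aE bE mk cs'; apply: (coherent_update I bS aE) => //.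
  - by rewrite bE; case: (mk h).
  - by move=> u; rewrite bE; case: (mk u) => _ _ ->.
  - move=> u uu; rewrite bE; case: (mk u) => _ oE pE vE;
      rewrite /marks oE pE vE.
    exact: coherent_marks I _ uu.
  - exact: coherent_size I.
  - by move=> d iE; rewrite iE ltnNge leq_b1 in lt1.
move: ext; rewrite {}/cf' => ext.
case stE: (agents cf b) cs => [v s|u v s||t] /= cs; last 2 first.
- by apply: (ext _ Killed _ erefl); rewrite /step ?stE //;
    apply/ffunP => b'; rewrite ffunE; case: eqP => [->|].
- by apply: (ext _ (Reported t) _ erefl); rewrite /step ?stE //;
    apply/ffunP => b'; rewrite ffunE; case: eqP => [->|] //.
- case: cs => m sE; move: ext; rewrite (step_at _ stE) sE /=.
  case: ifP => _ /=.
    case: (program v m _) => [[m' b'] ac] ext.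
    apply: ext erefl erefl _ _.
      by move=> u; rewrite ffunE; case: eqVneq => [->|].
    by case: ac => [|w|w] /=; [|case: ifP => _ /=|case: ifP => _ /=];
      try exists m'.
  move=> ext; apply: ext erefl erefl _ _; last by exists m.
  by move=> u; rewrite ffunE; case: eqVneq => [->|].
- case: cs => m sE; move: ext; rewrite /step stE sE /= => ext.
  apply: ext erefl erefl _ _ => //; case: ifP => //= _; by exists m.
Qed.

Lemma coherent_step S P cf b kill : coherent x S P cf ->
  coherent x (enlist S b) (new_progress S P b (stepx b kill cf))
    (stepx b kill cf).
Proof.
move=> I; rewrite /enlist; case: ifPn => bS; last first.
  have -> : new_progress S P b (stepx b kill cf) = P.
    by apply/funext => d; rewrite /new_progress (negPf bS).
  exact: coherent_fresh_step.
have [lt1|le1] := ltnP 1 (index b S); first exact: coherent_copy_step.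
apply: (@coherent_explorer_step _ _ _ _ _ (index b S == 1)) => //.
by case: (index b S) le1 => [|[|]].
Qed.

(** * Trusted nodes *)

Lemma boards_mono cf b kill u :
  (passed (boards cf u) -> passed (boards (stepx b kill cf) u)) /\
  (vouched (boards cf u) -> vouched (boards (stepx b kill cf) u)).
Proof.
rewrite /step; case: (agents cf b) => [v s|v w s||w] //.
case sE: (program _ _ _) => [[s' b'] ac] /=; rewrite ffunE.
case: eqVneq => [->|//]; move: sE => /=.
case: s => [|d k|d k t|c m] /=.
- by case: started => many parity [_ <- _].
- case: (drop _ _) => [[_ <- _] //|[w|||] r]; try by case=> _ <- _.
  by case: ifP => _ [_ <- _].
- by case: ifP => _ [_ <- _].
- case: ifP => _; last by case=> _ <- _.
  by case: (program _ _ _) => [[m' s'']  ac'] [_ <- _].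
Qed.

Lemma trusted_step cf b kill c u :
  trusted G c u (boards cf u) -> trusted G c u (boards (stepx b kill cf) u).
Proof.
have [pm vm] := boards_mono cf b kill u; rewrite /trusted.
by case/or3P=> [->//|/vm->|/andP[/pm-> ->]]; rewrite ?orbT.
Qed.

Lemma marks_bounds (st : progress V) :
  [/\ cleared st <= owned st, owned st <= (cleared st).+1,
      (cleared st).-1 <= vouches st & vouches st <= (owned st).-1].
Proof. by case: st => p i []; rewrite /owned /vouches /=; split; lia. Qed.

Lemma idx_surj d i : i < size us -> exists2 u, u \in us & idx G d u = i.
Proof.
move=> lti; exists (nth h (ords G d) i); last exact: idx_nth.
by rewrite -(mem_ords G d) mem_nth ?size_ords.
Qed.

(** If the counts overlapped, the target claimed last by explorer [false] would be owned by both. *)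
Lemma owned_disjoint S P cf : coherent x S P cf ->
  owned (prog G false (P false)) + owned (prog G true (P true)) <= size us.
Proof.
move=> I; rewrite leqNgt; apply/negP => lt.
have le1 := cleared_le G false (P false); have le2 :=
  cleared_le G true (P true).
set i := (owned (prog G false (P false))).-1.
have lti : i < size us by rewrite /i; lia.
have [u uu il] := idx_surj false lti; have [mo _ _] := coherent_marks I uu.
have /= := idx_opp false uu; rewrite il => ir.
have /eqP o1 : owner (boards cf u) == Some false by rewrite mo il /i; lia.
have : owner (boards cf u) == Some true by rewrite mo; lia.
by rewrite o1.
Qed.

(** An unclaimed target is trusted by neither copy. If there is none, the targets claimed last are
    neighbours in the order; neither is vouched and their parities differ, so copy [c] distrusts one
    of them. *)
Lemma untrusted_exists S P cf c : coherent x S P cf ->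
  exists2 z, z \in us & ~~ trusted G c z (boards cf z).
Proof.
move=> I; have dis := owned_disjoint I.
have le1 := cleared_le G false (P false); have le2 :=
  cleared_le G true (P true).
have [c1 c1' w1 v1] := marks_bounds (prog G false (P false)).
have [c2 c2' w2 v2] := marks_bounds (prog G true (P true)).
set a := owned (prog G false (P false)) in dis le1 c1 c1' v1.
set a' := owned (prog G true (P true)) in dis le2 c2 c2' v2.
(* Index [a] is unclaimed or was claimed last by explorer [true]; index [a.-1] was claimed last by
   explorer [false]. *)
pose i := if (a + a' < size us) || (odd a != c) then a else a.-1.
have us0 := plan_gt0 G.
have lti : i < size us by rewrite /i; case: ifP => _; lia.
have [u uu il] := idx_surj false lti; exists u => //.
have [_ pE vE] := coherent_marks I uu; rewrite /trusted (notin_h uu) /= pE vE.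
have /= := idx_opp false uu; rewrite -/(idx G false _) /either il => ir.
by move: il ir; rewrite /i; case: ifP => [/orP[|]|/negbT]; case: c {i lti}; lia.
Qed.

(** All targets on either side of [x] have been passed, and among them only the neighbours of [x] in
    the order, whose parity is [c], can lack a voucher. Disjointness of the claims excludes that [x]
    is vouched, whether or not it has been passed. *)
Lemma killed_trusted S P cf c : coherent x S P cf -> x != h ->
  (forall d, exists2 b, b \in S & index b S = d :> nat /\
    agents cf b = Killed) ->
  c = ~~ odd (idx G false x) ->
  ~~ trusted G c x (boards cf x) /\
  forall u, u != x -> trusted G c u (boards cf u).
Proof.
move=> I xh kl cE; have dis := owned_disjoint I.
have xu : x \in us by apply: plan_all xh.
have lec d : idx G d x <= cleared (prog G d (P d)).
  have [b bS [iE st]] := kl d; have := coherent_explorer I bS iE.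
  by rewrite st /= known_idx.
have lec1 := lec false; have lec2 := lec true.
have [c1 c1' w1 v1] := marks_bounds (prog G false (P false)).
have [c2 c2' w2 v2] := marks_bounds (prog G true (P true)).
have /= ox := idx_opp false xu; have ltx := idx_lt (G := G) false xu.
split.
  have [_ _ vE] := coherent_marks I xu; rewrite /trusted (notin_h xu)
    /= vE /either.
  by rewrite -/(idx G false x) cE; case: (odd _); rewrite ?andbF ?orbF; lia.
move=> u ux; rewrite /trusted; have [//|uh] := eqVneq u h.
have uu : u \in us by apply: plan_all uh.
have [_ pE vE] := coherent_marks I uu; rewrite pE vE /either -/(idx G false u)
  /=.
have /= ou := idx_opp false uu.
have nu : idx G false u != idx G false x.
  by rewrite idx_eq // nth_idx.
rewrite {}cE; have [pu|pu] := eqVneq (odd (idx G false u))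
  (~~ odd (idx G false x)).
  rewrite andbT; apply/orP; right; apply/orP.
  move: nu lec1 lec2 ox ou; clear; rewrite neq_ltn => /orP[] lt lec1 lec2 ox ou.
    by left; lia.
  by right; lia.
rewrite andbF orbF; apply/orP.
have /orP[lt|gt] : (idx G false u < idx G false x)
  || (idx G false x < idx G false u).
    by rewrite -neq_ltn.
  by left; move: pu lt lec1 w1; clear; lia.
by right; move: pu gt lec2 w2 ox ou; clear; lia.
Qed.

(** * Simulation of the black hole search *)

Definition arun z (l : seq 'I_(nagents A)) : config A :=
  foldl (fun X i => step e h z i true X) (config0 h A) l.

Lemma arun_reported z l l' a w : agents (arun z l) a = Reported w ->
  agents (arun z (l ++ l')) a = Reported w.
Proof.
rewrite /arun foldl_cat.
elim: l' (foldl _ _ l) => //= i l' IH X aR.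
apply: IH; rewrite /step; case iE: (agents X i) => [v s|u v s||t] //.
  case: (program (p := A) v s _) => [[s' b'] ac] /=; rewrite ffunE.
  by case: eqP => // ai; rewrite ai iE in aR.
by rewrite ffunE; case: eqP => // ai; rewrite ai iE in aR.
Qed.

Lemma arun_run z (s : nat -> 'I_(nagents A)) i :
  run e h z (fun l => s (size l)) (fun=> true) i = arun z (mkseq s i).
Proof.
elim: i => [//|i IH]; rewrite [LHS]/= IH size_mkseq.
by rewrite /arun /mkseq -[in RHS]addn1 iotaD map_cat foldl_cat.
Qed.

(** A schedule fixed in advance is an adversary that looks only at the number of coins flipped. *)
Lemma bhs_fair (R : realType) t m z (s : nat -> 'I_(nagents A)) :
  solves_BHS R e h A t m -> z != h ->
  (forall a i, exists2 j, i <= j & s j = a) ->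
  correct_output z (fun i => arun z (mkseq s i)) /\
  forall i, moves (arun z (mkseq s i)) <= m.
Proof.
move=> [_ sol] zh fair_s.
have fr : fair (1 : R)%R (fun l => s (size l) : 'I_(nagents A)).
  move=> coin _ a i; have [j leij sj] := fair_s a i.
  by exists j; rewrite ?size_mkseq.
have [[[i ri] ro] mv] := sol z zh _ fr (fun=> true) (fun _ _ => erefl).
split; first split.
- by exists i; rewrite -arun_run.
- by move=> j w; rewrite -arun_run; apply: ro.
- by move=> j; rewrite -arun_run.
Qed.

(** Every finite schedule extends to a fair one, so the safety guarantees of [A] hold along it. *)
Lemma bhs_prefix (R : realType) t m z l :
  solves_BHS R e h A t m -> z != h ->
  moves (arun z l) <= m /\ forall w, reported (arun z l) w -> w = z.
Proof.
(* The default value of [nth] continues [l] by a round robin over the agents. *)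
move=> sol zh; pose s i := nth (Ordinal (ltn_pmod i (nagents_gt0 A))) l i.
have fair_s a i : exists2 j, i <= j & s j = a.
  exists (a + (i + size l) * nagents A).
    have := nagents_gt0 A; nia.
  rewrite /s nth_default; last by have := nagents_gt0 A; nia.
  by apply: val_inj; rewrite /= addnC modnMDl modn_small.
have [[_ ro] mv] := bhs_fair sol zh fair_s.
have lE : l = mkseq s (size l).
  apply: (@eq_from_nth _ (Ordinal (nagents_gt0 A)));
    rewrite ?size_mkseq // => i lti.
  by rewrite nth_mkseq // /s; apply: set_nth_default.
by rewrite lE; split=> // w; apply: ro.
Qed.

(* A copied agent that waits at the node [z], which it does not trust, has been
   killed in the run of [A] with black hole [z].  If it is killed by another
   node, then it is not scheduled any more in this run. *)
Definition shadow z (st : agent_state V (memory Ar))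
    (stA : agent_state V (memory A)) : Prop :=
  match st with
  | At w (Copy _ m) => stA = if w == z then Killed else At w m
  | InTransit u w (Copy _ m) => stA = InTransit u w m /\ u != z
  | Reported w => stA = Reported w
  | Killed => z = x -> stA = Killed
  | _ => False
  end.

(* Agent [i] of copy [c] is the agent of index [2 i + c + 2] in the order in
   which the agents started. *)
Record simulates c z S cf (X : config A) : Prop := Simulates {
  sim_boards : forall w, sheets (boards cf w) c = boards X w;
  sim_wait : forall i : 'I_(nagents A), size S <= (i.*2 + c).+2 ->
    agents X i = At h (memory0 A);
  sim_agent : forall b (i : 'I_(nagents A)), b \in S ->
    index b S = (i.*2 + c).+2 -> shadow z (agents cf b) (agents X i)
}.

Lemma simulates0 c z : simulates c z [::] (config0 h Ar) (config0 h A).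
Proof. by split=> //= [w|i _]; rewrite !ffunE. Qed.

Definition member c S b := [&& b \in S, 1 < index b S & odd (index b S) == c].

(** Selects the scheduled agents that are handed on to the run of [A]. An agent waiting at an
    untrusted node other than [z] is merely delayed there, as asynchrony allows. One that waits at
    [z] or was killed by [z] is already dead in that run, so handing it on has no effect but to keep
    the schedule fair. *)
Definition active c z cf b :=
  match agents cf b with
  | At w _ => trusted G c w (boards cf w) || (w == z)
  | Killed => z == x
  | _ => true
  end.

Definition copied c z S cf b : option 'I_(nagents A) :=
  if member c S b && active c z cf b then insub (index b S)./2.-1 else None.

Definition travels cf b := if agents cf b is InTransit _ _ _ then true else
  false.

Definition astep z (o : option 'I_(nagents A)) (X : config A) :=
  if o is Some i then step e h z i true X else X.

Lemma moves_step cf b kill : moves (stepx b kill cf) = moves cf + travels cf b.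
Proof.
rewrite /step /travels; case: (agents cf b) => [v s|v w s||w] //=;
  rewrite ?addn0 ?addn1 //.
by case: (search_program _ _ _) => [[? ?] ?].
Qed.

Lemma copy_index n : 1 < n -> n = ((n./2).-1.*2 + odd n).+2.
Proof. by have := odd_double_half n; case: odd => /=; lia. Qed.

Lemma index_lt S b : uniq S -> b \in S -> index b S < (nagents A).*2.+2.
Proof.
move=> Su bS; apply: leq_trans (_ : size S <= _); first by rewrite index_mem.
by rewrite -(card_uniqP Su) -[X in _ <= X](card_ord (nagents Ar)) max_card.
Qed.

Lemma copy_lt S b : uniq S -> b \in S -> 1 < index b S ->
  (index b S)./2.-1 < nagents A.
Proof. by move=> Su bS lt1; have := index_lt Su bS; lia. Qed.

Lemma simulates_other c z S cf cf' b st X : uniq S -> b \in S ->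
  ~~ member c S b ->
  agents cf' = set_agent cf b st ->
  (forall w, sheets (boards cf' w) c = sheets (boards cf w) c) ->
  simulates c z S cf X -> simulates c z S cf' X.
Proof.
move=> Su bS nm aE sE [sb sw sa]; split=> // [w|b' i b'S iE];
  first by rewrite sE.
rewrite aE ffunE; case: eqVneq => [bE|_]; last exact: sa.
case/negP: nm; rewrite /member bS -bE iE /= negbK oddD odd_double oddb.
exact: eqxx.
Qed.

Lemma simulates_self c z S cf cf' b st X X' (i : 'I_(nagents A)) : b \in S ->
  index b S = (i.*2 + c).+2 ->
  agents cf' = set_agent cf b st ->
  (forall w, sheets (boards cf' w) c = boards X' w) ->
  (forall j, j != i -> agents X' j = agents X j) ->
  shadow z st (agents X' i) ->
  simulates c z S cf X -> simulates c z S cf' X'.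
Proof.
move=> bS iE aE bE XE sh [sb sw sa]; split=> // [j lej|b' j b'S jE].
  rewrite XE ?sw //; apply/eqP => ji; move: lej;
    rewrite ji -iE leqNgt index_mem.
  by rewrite bS.
rewrite aE ffunE; case: eqVneq => [b'b|nb].
  have -> : j = i by apply: val_inj; move: jE; rewrite b'b iE /=; lia.
  by [].
rewrite XE; first exact: sa.
apply: contraNneq nb => ji; rewrite ji -iE in jE.
by rewrite -(nth_index b b'S) jE nth_index.
Qed.

(** While [z] is untrusted no agent of the copy acts there, as if it had died on arrival; at trusted
    nodes it performs the step of [A] on its own sheet. So it never leaves [z], and its completed
    moves are those of the run of [A]. *)
Lemma simulates_step c z S P cf X b kill :
  coherent x S P cf -> z != h -> ~~ trusted G c z (boards cf z) ->
  simulates c z S cf X ->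
  let X' := astep z (copied c z S cf b) X in
  simulates c z (enlist S b) (stepx b kill cf) X' /\
  moves X' = moves X + (member c S b && travels cf b).
Proof.
move=> I zh nz sim; have Su := coherent_uniq I.
rewrite /copied /enlist; have [bS|nb] := boolP (b \in S); last first.
  rewrite /member (negPf nb) /= addn0; split=> //; case: (sim) => sb sw sa.
  have stE := coherent_fresh I nb; have Ss := coherent_started I.
  have aE : agents (stepx b kill cf) =
      set_agent cf b (At h (if 1 < size S then Copy (odd (size S)) (memory0 A)
                            else Forth (odd (size S)) ord0)).
    by rewrite (step_at _ stE) /= Ss.
  split=> [w|i|b' i].
  - rewrite -sb (step_at _ stE) /= Ss /= ffunE.
    by case: eqVneq => [->|].
  - by rewrite size_rcons => /ltnW; apply: sw.
  - rewrite mem_rcons in_cons aE ffunE; case: eqVneq => [-> _|nE /= b'S].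
      rewrite -cats1 index_cat (negPf nb) /= eqxx addn0 => sE.
      by rewrite sE /= (sw i) ?sE //= eq_sym (negPf zh).
    by rewrite -cats1 index_cat b'S; apply: sa.
have [mb|nm] /= := boolP (member c S b); last first.
  rewrite addn0; split=> //.
  have other st : agents (stepx b kill cf) = set_agent cf b st ->
      (forall w, sheets (boards (stepx b kill cf) w) c = sheets (boards cf w)
        c) ->
      simulates c z S (stepx b kill cf) X.
    by move=> aE sE; apply: (simulates_other Su bS nm aE sE sim).
  case stE: (agents cf b) => [v s|u v s||t].
  - case sE: (search_program (G := G) v s (boards cf v)) => [[s' b'] ac].
    rewrite (step_at _ stE) sE in other *; apply: (other _ erefl) => w /=.
    rewrite ffunE; case: eqVneq => [->|//]; move: sE.
    case: s stE {other} => [|d k|d k t|c' m] stE /=.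
    + by case: started => many parity [_ <- _].
    + case: (drop _ _) => [[_ <- _] //|[w'|||] r]; try by case=> _ <- _.
      by case: ifP => _ [_ <- _].
    + by case: ifP => _ [_ <- _].
    + case: ifP => _; last by case=> _ <- _.
      case: (program _ _ _) => [[m' s'']  ac'] [_ <- _] /=.
      rewrite ffunE; case: eqP => // cE; case/negP: nm; rewrite /member bS.
      have [lt1|le1] := ltnP 1 (index b S).
        have := coherent_copy I bS lt1; rewrite stE /= => -[m1 [c'E _]].
        by rewrite cE c'E eqxx.
      have iE : index b S = (index b S == 1) by case: (index b S) le1 => [|[]].
      by have := coherent_explorer I bS iE; rewrite stE.
  - by rewrite /step stE in other *; apply: (other _ erefl).
  - rewrite /step stE in other *; apply: (other Killed) => //.
    by apply/ffunP => b'; rewrite ffunE; case: eqP => [->|].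
  - rewrite /step stE in other *; apply: (other (Reported t)) => //.
    by apply/ffunP => b'; rewrite ffunE; case: eqP => [->|].
case/and3P: (mb) => _ lt1 /eqP odE.
have ltA : (index b S)./2.-1 < nagents A by exact: copy_lt.
pose i := Ordinal ltA.
have iE : index b S = (i.*2 + c).+2 by rewrite -odE; apply: copy_index.
have -> : insub (index b S)./2.-1 = Some i by rewrite insubT.
have := coherent_copy I bS lt1; rewrite odE => cs.
have [sb sw sa] := sim; have := sa b i bS iE.
have self st X' : agents (stepx b kill cf) = set_agent cf b st ->
    (forall w, sheets (boards (stepx b kill cf) w) c = boards X' w) ->
    (forall j, j != i -> agents X' j = agents X j) ->
    shadow z st (agents X' i) -> simulates c z S (stepx b kill cf) X'.
  by move=> aE bE XE sh; apply: simulates_self bS iE aE bE XE sh sim.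
have selfid st : agents (stepx b kill cf) = set_agent cf b st ->
    boards (stepx b kill cf) = boards cf -> shadow z st (agents X i) ->
    simulates c z S (stepx b kill cf) X.
  by move=> aE bE sh; apply: self aE _ _ sh => // w; rewrite bE sb.
rewrite /active /travels; case stE: (agents cf b) cs => [v s|u v s||t] /= cs.
- case: cs => m sE; rewrite sE => XE; rewrite addn0.
  have [tr|ntr] /= := boolP (trusted G c v (boards cf v)).
    have vz : v == z = false by apply: contraNF nz => /eqP <-.
    rewrite vz in XE; move: self; rewrite (step_at _ stE)
      sE /= tr -?/(trusted _ _ _ _).
    rewrite /step XE sb; case: (program v m _) => [[m' b'] ac] /= self;
      split=> //.
    apply: (self _ _ erefl) => /=.
    + move=> w; rewrite !ffunE; case: (eqVneq w v) => [_|_]; last exact: sb.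
      by rewrite /= ffunE eqxx.
    + by move=> j ji; rewrite ffunE (negPf ji).
    + rewrite ffunE eqxx; case: (ac) => [|w|w] /=; rewrite ?vz //;
        case: ifP => _ //=;
        rewrite ?vz //.
  have XS : astep z (if v == z then Some i else None) X = X.
    rewrite /=; case: ifP => // vz; rewrite vz in XE; by rewrite /= /step XE.
  rewrite XS; split=> //; apply: (selfid (At v (Copy c m))).
  + by rewrite (step_at _ stE) sE /= (negPf ntr).
  + rewrite (step_at _ stE) sE /= (negPf ntr) /=.
    by apply/ffunP => w; rewrite ffunE; case: eqVneq => [->|].
  + exact: XE.
- case: cs => m sE; rewrite sE => -[XE uz]; rewrite /step XE addn1 /=;
    split=> //.
  apply: self; rewrite /step ?stE //=.
  + by move=> j ji; rewrite ffunE (negPf ji).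
  (* The agent does not come from [z]; if [z] is the hole that killed it, it was arriving at [z],
     where the agent of [A] dies too. *)
  + rewrite ffunE eqxx andbT (negPf uz) /= sE; case: ifP => //= /andP[ux _] zx.
    by case/orP: ux => /eqP E; [rewrite E zx eqxx in uz | rewrite E zx eqxx].
- move=> XE; rewrite addn0; have XS : astep z (if z == x then Some i else None)
    X = X.
    by rewrite /=; case: eqP => // zx; rewrite /= /step XE.
  rewrite XS; split=> //; apply: (selfid Killed); rewrite /step ?stE //.
  by apply/ffunP => b'; rewrite ffunE; case: eqP => [->|].
- move=> XE; rewrite addn0 /step XE; split=> //.
  apply: (selfid (Reported t)); rewrite /step ?stE //.
  by apply/ffunP => b'; rewrite ffunE; case: eqP => [->|].
Qed.

(** * Executions *)

(** Termination measure of an explorer: [2 * maxlen G] leaves room for a retreat after the script,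
    and the factor 3 pays for the departure and the arrival of each move. *)
Definition steps_left (st : agent_state V (memory Ar)) : nat :=
  match st with
  | At _ Fresh => 6 * maxlen G + 1
  | At _ (Forth _ k) => 3 * (2 * maxlen G - k)
  | InTransit _ _ (Forth _ k) => 3 * (2 * maxlen G - k) + 1
  | At _ (Retreat _ k _) => 3 * k.+1
  | InTransit _ _ (Retreat _ k _) => 3 * k.+1 + 1
  | _ => 0
  end.

Lemma steps_left_step S P cf b d kill : coherent x S P cf ->
  b \in S -> index b S = d :> nat ->
  let st := agents cf b in
  steps_left (agents (stepx b kill cf) b) + (if st is (Killed | Reported _)
    then 0 else 1)
    <= steps_left st.
Proof.
move=> I bS iE /=; have es := coherent_explorer I bS iE;
  have leP := coherent_size I d.
rewrite /step; case stE: (agents cf b) es => [v s|u v s||t] /=; last 2 first.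
- by rewrite stE.
- by rewrite stE.
- case: s stE => [|d' k|d' k t|c m] stE //= [dd].
    move=> kE vE; subst d'; have ltk := ltn_ord k.
    case dE: (drop k (scr d)) => [|ins r] /=; first by rewrite ffunE eqxx /=;
      lia.
    have ltk' : k.+1 < maxlen G.
      by apply: (lt_maxlen (d := d)); have [] := progS dE.
    have kE' : (inord k.+1 : 'I_(maxlen G)) = k.+1 :> nat by rewrite inordK.
    case: ins {dE} => [w|||] /=; rewrite ?ffunE ?eqxx /=.
    + by case: ifP => _ /=; rewrite kE'; lia.
    + by case: ifP => _ /=; rewrite ffunE eqxx /= ?kE'; lia.
    + by rewrite kE'; lia.
    + by rewrite kE'; lia.
  move=> lek vE _ _; case: eqP => k0 /=; rewrite ffunE eqxx /=.
    by rewrite vE k0 prog0 eqxx.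
  have kE' : (inord k.-1 : 'I_(maxlen G)) = k.-1 :> nat by rewrite inordK //;
    have := ltn_ord k; lia.
  by case: ifP => _ /=; rewrite kE'; lia.
- by case: s stE => [|d' k|d' k t|c m] stE //= _; rewrite ffunE eqxx;
    case: ifP => _ /=; lia.
Qed.

Section Execution.
Variables (adv : adversary Ar) (coin : nat -> bool).

Local Notation cfg := (run e h x adv coin).
Local Notation sched j := (adv (mkseq coin j)).

Fixpoint enlisted j : seq agent :=
  if j is i.+1 then enlist (enlisted i) (sched i) else [::].

Fixpoint progress_at j : bool -> nat :=
  if j is i.+1 then new_progress (enlisted i) (progress_at i) (sched i) (cfg j)
  else fun=> 0.

Lemma coherent_run j : coherent x (enlisted j) (progress_at j) (cfg j).
Proof. by elim: j => [|j IH]; [exact: coherent0 | exact: coherent_step]. Qed.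

Lemma trusted_run c u i j : i <= j ->
  trusted G c u (boards (cfg i) u) -> trusted G c u (boards (cfg j) u).
Proof.
elim: j => [|j IH]; first by rewrite leqn0 => /eqP->.
rewrite leq_eqVlt => /orP[/eqP->//|lei] /(IH lei); exact: trusted_step.
Qed.

Lemma passed_run u i j : i <= j ->
  passed (boards (cfg i) u) -> passed (boards (cfg j) u).
Proof.
elim: j => [|j IH]; first by rewrite leqn0 => /eqP->.
rewrite leq_eqVlt => /orP[/eqP->//|lei] /(IH lei).
by have [] := boards_mono (cfg j) (sched j) (coin j) u.
Qed.

Lemma enlisted_mono i j : i <= j -> exists s, enlisted j = enlisted i ++ s.
Proof.
apply: chain_prefix => k; rewrite /= /enlist; case: ifP => _.
  by exists [::]; rewrite cats0.
by exists [:: sched k]; rewrite cats1.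
Qed.

Lemma enlisted_index i j b : i <= j -> b \in enlisted i ->
  b \in enlisted j /\ index b (enlisted j) = index b (enlisted i).
Proof.
by move=> /enlisted_mono[s ->] bi; rewrite mem_cat bi index_cat bi.
Qed.

Fixpoint copied_run c z j : seq 'I_(nagents A) :=
  if j is i.+1 then
    copied_run c z i ++
      (if copied c z (enlisted i) (cfg i) (sched i) is Some a then [::
        a] else [::])
  else [::].

Lemma arun_copied c z j :
  arun z (copied_run c z j.+1) =
  astep z (copied c z (enlisted j) (cfg j) (sched j))
    (arun z (copied_run c z j)).
Proof. by rewrite /arun /= foldl_cat; case: copied. Qed.

Lemma simulates_run c z j : z != h -> ~~ trusted G c z (boards (cfg j) z) ->
  simulates c z (enlisted j) (cfg j) (arun z (copied_run c z j)).
Proof.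
move=> zh; elim: j => [|j IH] nz; first exact: simulates0.
have nz' : ~~ trusted G c z (boards (cfg j) z).
  by apply: contra nz; apply: trusted_step.
rewrite arun_copied; have I := coherent_run j.
by have [] := simulates_step (sched j) (coin j) I zh nz' (IH nz').
Qed.

Definition lead j (d : bool) : agent_state V (memory Ar) :=
  if d < size (enlisted j) then agents (cfg j) (nth ord0 (enlisted j) d)
  else At h Fresh.

Lemma steps_left_lead j d :
  steps_left (lead j.+1 d) +
    [&& sched j \in enlisted j, index (sched j) (enlisted j) == d :> nat &
        travels (cfg j) (sched j)] <= steps_left (lead j d).
Proof.
have I := coherent_run j; have I' := coherent_run j.+1.
set b := sched j; set S := enlisted j.
have agE b' : b' != b -> agents (cfg j.+1) b' = agents (cfg j) b'.
  exact: agents_other.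
rewrite /lead -/S; have [bS|nb] := boolP (b \in S); last first.
  rewrite addn0 [enlisted j.+1]/= /enlist -/S -/b (negPf nb)
    size_rcons nth_rcons.
  case: (ltngtP d (size S)) => [ltd|gtd|dE].
  - rewrite (leqW ltd) agE //.
    by apply: contraNneq nb => <-; apply: mem_nth.
  - by have -> : (d < (size S).+1) = false by lia.
  - rewrite dE ltnSn.
    have stE := coherent_fresh I nb.
    rewrite /= (step_at _ stE) -/b /=.
    case: started => many parity /=; rewrite ffunE eqxx.
    by case: many => /=; lia.
rewrite [enlisted j.+1]/= /enlist -/S -/b bS.
case: (eqVneq (index b S) d) => [iE|nE] /=.
  have ltd : d < size S by rewrite -iE index_mem.
  have nthE : nth ord0 S d = b by rewrite -iE nth_index.
  have := steps_left_step (coin j) I bS iE; rewrite ltd nthE /= /travels -/b.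
  by case: (agents (cfg j) b) => [v s|u v s||t]; lia.
rewrite addn0; case: ltnP => // ltd; rewrite agE //.
by apply: contraNneq nE => <-; rewrite index_uniq // (coherent_uniq I).
Qed.

(** Amortized count: a completed move is made either by an explorer and lowers its [steps_left], or
    by a copy and is also made in the corresponding run of [A]. The last term is the measure of two
    fresh explorers. *)
Lemma moves_run N (z0 z1 : V) : z0 != h -> z1 != h ->
  ~~ trusted G false z0 (boards (cfg N) z0) ->
  ~~ trusted G true z1 (boards (cfg N) z1) ->
  moves (cfg N) + steps_left (lead N false) + steps_left (lead N true) <=
  moves (arun z0 (copied_run false z0 N)) + moves (arun z1 (copied_run true z1
    N))
    + 2 * (6 * maxlen G + 1).
Proof.
move=> h0 h1; elim: N => [|j IH] n0 n1; first by rewrite /lead /=; lia.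
have back c z : ~~ trusted G c z (boards (cfg j.+1) z) ->
    ~~ trusted G c z (boards (cfg j) z).
  by apply: contra; apply: trusted_step.
have m0 := back _ _ n0; have m1 := back _ _ n1.
have I := coherent_run j.
have [_ v0] := simulates_step (sched j) (coin j) I h0 m0 (simulates_run h0 m0).
have [_ v1] := simulates_step (sched j) (coin j) I h1 m1 (simulates_run h1 m1).
have l0 := steps_left_lead j false; have l1 := steps_left_lead j true.
rewrite !arun_copied v0 v1 [cfg j.+1]/= moves_step.
have {IH} := IH m0 m1; move: l0 l1; rewrite /member.
case tr: (travels (cfg j) (sched j)); rewrite ?andbF ?andbT; last first.
  by clear; lia.
have [bS|nb] /= := boolP (sched j \in enlisted j); last first.
  by rewrite /travels (coherent_fresh I nb) in tr.
by clear; case: (index _ _) => [|[|n]] /=; [lia | lia | case: odd => /=; lia].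
Qed.

Lemma nagents_Ar : nagents Ar = (nagents A).*2.+2. Proof. by []. Qed.

(** The nodes [z0] and [z1] are chosen at time [N]. As trust is never withdrawn, they were untrusted
    all along, so the two runs of [A] with these holes account for all moves of the copies. *)
Lemma moves_bound (R : realType) t m N : solves_BHS R e h A t m ->
  moves (cfg N) <= 2 * m + 2 * (6 * maxlen G + 1).
Proof.
move=> sol; have us_h z : z \in us -> z != h by move=> zu; rewrite (notin_h zu).
have [z0 /us_h h0 n0] := untrusted_exists false (coherent_run N).
have [z1 /us_h h1 n1] := untrusted_exists true (coherent_run N).
have := moves_run h0 h1 n0 n1.
have [m0 _] := bhs_prefix (copied_run false z0 N) sol h0.
have [m1 _] := bhs_prefix (copied_run true z1 N) sol h1.
by move: m0 m1; clear; lia.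
Qed.

Lemma untrusted_unpassed S P cf c : coherent x S P cf -> x != h ->
  ~~ passed (boards cf x) -> ~~ trusted G c x (boards cf x).
Proof.
move=> I xh np; have xu : x \in us by apply: plan_all.
rewrite /trusted (negPf xh) (negPf np) orbF.
have [_ pE vE] := coherent_marks I xu; apply: contra np; rewrite pE vE /=.
have v_le (st : progress V) : vouches st <= cleared st.
  by have [_ + _] := marks_bounds st; lia.
by rewrite /either => /orP[] lt; rewrite (leq_trans lt (v_le _)) ?orbT.
Qed.

(** No copy trusts an unpassed hole, so the reports of a copy are those of [A] with black hole [x].
    An explorer reports a node only if all other targets are passed. *)
Lemma reported_correct (R : realType) t m i w : solves_BHS R e h A t m ->
  x != h -> ~~ passed (boards (cfg i) x) -> reported (cfg i) w -> w = x.
Proof.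
move=> sol xh np [b bR]; have I := coherent_run i.
have bS : b \in enlisted i.
  by apply/negP => /negP nb; rewrite (coherent_fresh I nb) in bR.
have xu : x \in us by apply: plan_all.
have [lt1|le1] := ltnP 1 (index b (enlisted i)).
  set c := odd (index b (enlisted i)).
  have nx := untrusted_unpassed c I xh np.
  have sim := simulates_run xh nx.
  have ltA : (index b (enlisted i))./2.-1 < nagents A.
    exact: copy_lt (coherent_uniq I) bS lt1.
  have iE : index b (enlisted i) = ((Ordinal ltA).*2 + c).+2 by apply:
    copy_index.
  have := sim_agent sim bS iE; rewrite bR /= => aR.
  have [_ rE] := bhs_prefix (copied_run c x i) sol xh.
  by apply: rE; exists (Ordinal ltA).
have iE : index b (enlisted i) = (index b (enlisted i) == 1).
  by case: (index b (enlisted i)) le1 => [|[]].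
have := coherent_explorer I bS iE; rewrite bR /= => oth.
by apply/eqP; rewrite eq_sym; apply: contraNT np => xw; apply: oth.
Qed.

(** * Termination under a fair schedule *)

Hypothesis fair_sched : forall a i, exists2 j, i <= j & sched j = a.

Lemma all_enlisted : exists T, forall b, b \in enlisted T.
Proof.
have ex b : exists T, b \in enlisted T.
  have [j _ jb] := fair_sched b 0; exists j.+1.
  by rewrite /= /enlist jb; case: ifP => // _; rewrite mem_rcons mem_head.
have [f fP] := choice ex; exists (\max_b f b) => b.
by have [] := enlisted_index (leq_bigmax b) (fP b).
Qed.

Definition stopped (st : agent_state V (memory Ar)) :=
  match st with Killed | Reported _ => true | _ => false end.

Lemma stopped_run i j b : i <= j -> stopped (agents (cfg i) b) ->
  agents (cfg j) b = agents (cfg i) b.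
Proof.
move=> leij st; elim: j leij => [|j IH]; first by rewrite leqn0 => /eqP->.
rewrite leq_eqVlt => /orP[/eqP->//|/IH E]; rewrite [cfg j.+1]/= -E.
have [bE|nb] := eqVneq b (sched j); last exact: agents_other.
by move: st; rewrite -E bE /step; case stE: (agents (cfg j) (sched j)).
Qed.

Lemma unscheduled_run b i j : i <= j ->
  (forall k, i <= k < j -> sched k <> b) -> agents (cfg j) b = agents (cfg i) b.
Proof.
elim: j => [|j IH]; first by rewrite leqn0 => /eqP->.
rewrite leq_eqVlt => /orP[/eqP->//|lei] ns.
rewrite -IH // => [|k /andP[leik ltkj]]; last by apply: ns; rewrite leik ltnW.
apply: agents_other; apply/eqP => bE.
by apply: (ns j) => //; rewrite ltnSn andbT.
Qed.

Lemma explorer_stops b T d : b \in enlisted T ->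
  index b (enlisted T) = d :> nat ->
  exists2 j, T <= j & stopped (agents (cfg j) b).
Proof.
move=> bS iE; have [n le_n] := ubnP (steps_left (agents (cfg T) b)).
elim: n T le_n bS iE => // n IH T; rewrite ltnS => le_n bS iE.
have [st|nst] := boolP (stopped (agents (cfg T) b)); first by exists T.
have [] := @ex_minnP (fun j => (T <= j) && (sched j == b)).
  by have [j lej jb] := fair_sched b T; exists j; rewrite lej jb eqxx.
move=> j /andP[leTj /eqP jb] minj.
have E : agents (cfg j) b = agents (cfg T) b.
  apply: unscheduled_run => // k /andP[leTk ltkj] kb.
  by have := minj k; rewrite leTk kb eqxx leqNgt ltkj => /(_ isT).
have [bSj iEj] := enlisted_index leTj bS.
have lt : steps_left (agents (cfg j.+1) b) < steps_left (agents (cfg T) b).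
  have := steps_left_step (coin j) (coherent_run j) bSj (etrans iEj iE).
  rewrite [cfg j.+1]/= jb E; case: (agents (cfg T) b) nst => //= *; lia.
have [bSj1 iEj1] := enlisted_index (leqW leTj) bS.
have [||k lek st] := IH j.+1 _ bSj1; first by lia.
  by rewrite iEj1.
by exists k => //; lia.
Qed.

(** Without a report both explorers die, and then one copy distrusts [x] alone. Its agents are held
    back nowhere else, so the schedule it induces for [A] is fair, and the report that [A] makes
    with black hole [x] is one of the copy. *)
Lemma terminates_run (R : realType) t m : solves_BHS R e h A t m -> x != h ->
  terminates cfg.
Proof.
move=> sol xh; apply: contrapT => nrep.
have {}nrep i w b : agents (cfg i) b <> Reported w.
  by move=> bR; apply: nrep; exists i, w, b.
have [T inT] := all_enlisted; have IT := coherent_run T.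
have szT : size (enlisted T) = (nagents A).*2.+2.
  rewrite -(card_uniqP (coherent_uniq IT)); apply:
    etrans (card_ord (nagents Ar)).
  by apply: eq_card => b; rewrite inT.
have nthT k : k < (nagents A).*2.+2 ->
    exists2 b, b \in enlisted T & index b (enlisted T) = k.
  move=> ltk; exists (nth ord0 (enlisted T) k); first exact: inT.
  by rewrite index_uniq ?szT // (coherent_uniq IT).
have killed d : exists2 j, T <= j & exists2 b, b \in enlisted T &
    index b (enlisted T) = d :> nat /\ agents (cfg j) b = Killed.
  have [|b bT iE] := nthT d; first by case: d.
  have [j leTj st] := explorer_stops bT iE; exists j => //; exists b => //.
  by split=> //; case stE: (agents (cfg j) b) st => // [w]; have := nrep j w b.
have [j0 le0 [b0 _ [i0 k0]]] := killed false.
have [j1 le1 [b1 _ [i1 k1]]] := killed true.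
(* From [T'] on both explorers are dead; [c] is the parity opposite to that of the hole. *)
pose T' := maxn j0 j1; pose c := ~~ odd (idx G false x).
have leT : T <= T' by rewrite /T' leq_max le0.
have inT' b j : T <= j -> b \in enlisted j /\ index b (enlisted j)
  = index b (enlisted T).
  by move=> leTj; apply: enlisted_index.
have trusts j : T' <= j -> ~~ trusted G c x (boards (cfg j) x) /\
    forall u, u != x -> trusted G c u (boards (cfg j) u).
  move=> leT'; apply: killed_trusted (coherent_run j) xh _ erefl => d.
  have lej0 : j0 <= j by apply: leq_trans leT'; rewrite leq_maxl.
  have lej1 : j1 <= j by apply: leq_trans leT'; rewrite leq_maxr.
  have leTj := leq_trans leT leT'.
  have [b0j ix0] := inT' b0 j leTj; have [b1j ix1] := inT' b1 j leTj.
  case: d.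
    by exists b1 => //; rewrite ix1 i1 (stopped_run lej1) k1.
  by exists b0 => //; rewrite ix0 i0 (stopped_run lej0) k0.
have nx j : ~~ trusted G c x (boards (cfg j) x).
  have [leT'|/ltnW lej] := leqP T' j; first by have [] := trusts j leT'.
  by have [nx _] := trusts T' (leqnn _); apply: contra nx; apply: trusted_run.
have sim j := simulates_run xh (nx j).
have copied_some j (i : 'I_(nagents A)) b : T' <= j -> sched j = b ->
    index b (enlisted T) = (i.*2 + c).+2 ->
    copied_run c x j.+1 = rcons (copied_run c x j) i.
  move=> leT' jb iE; have [bj ixj] := inT' b j (leq_trans leT leT').
  have act_b : active c x (cfg j) b.
    rewrite /active; case: (agents (cfg j) b) => [w s|u w s||w] //.
    by case: eqVneq => [->|wx]; rewrite ?orbT // (trusts j leT').2.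
  have mb : member c (enlisted j) b.
    by rewrite /member bj ixj iE /= negbK oddD odd_double oddb eqxx.
  have kE : ((i.*2 + c).+2)./2.-1 = i by case: (c); lia.
  by rewrite -cats1 /= jb /copied mb act_b /= ixj iE kE valK.
have indexT (i : 'I_(nagents A)) : exists b, index b (enlisted T)
  = (i.*2 + c).+2.
  have [|b _ iE] := nthT (i.*2 + c).+2; last by exists b.
  by have := ltn_ord i; case: (c) => /=; lia.
have grows j : exists s, copied_run c x j.+1 = copied_run c x j ++ s by eexists.
have copies (i : 'I_(nagents A)) n : exists j, [/\ T' <= j, n <= j &
    copied_run c x j.+1 = rcons (copied_run c x j) i].
  have [b iE] := indexT i; have [j lej jb] := fair_sched b (maxn T' n).
  move: lej; rewrite geq_max => /andP[leT' len].
  by exists j; split=> //; apply: copied_some iE.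
have extends i j : i <= j -> exists l, copied_run c x j = copied_run c x i ++ l.
  exact: chain_prefix.
have size_mono i j : i <= j -> size (copied_run c x i)
  <= size (copied_run c x j).
  by move=> /extends[l ->]; rewrite size_cat leq_addr.
have unbounded n : exists j, n <= size (copied_run c x j).
  elim: n => [|n [j lej]]; first by exists 0.
  have [k [_ lejk E]] := copies (Ordinal (nagents_gt0 A)) j.
  by exists k.+1; rewrite E size_rcons ltnS (leq_trans lej) // size_mono.
have [s sE] := chain_limit grows unbounded.
have fair_s a n : exists2 j, n <= j & s j = a.
  have [j0' le_n] := unbounded n; have [j [_ lej E]] := copies a j0'.
  exists (size (copied_run c x j)); first by apply:
    leq_trans le_n (size_mono _ _ lej).
  have := sE j.+1; rewrite E size_rcons => /(congr1 (fun l =>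
    nth a l (size (copied_run c x j)))).
  by rewrite nth_rcons ltnn eqxx nth_mkseq.
have [[[k [a aR]] _] _] := bhs_fair sol xh fair_s.
have [j lej] := unbounded k.
have {}aR : agents (arun x (copied_run c x j)) a = Reported x.
  rewrite sE -(subnKC lej) /mkseq iotaD map_cat; exact: arun_reported aR.
have leX : exists2 j', j <= j' & T <= j' by exists (maxn j T);
  rewrite ?leq_maxl ?leq_maxr.
have [j' lejj' leTj'] := leX.
have {}aR : agents (arun x (copied_run c x j')) a = Reported x.
  by have [l ->] := extends _ _ lejj'; apply: arun_reported.
have [b iE] := indexT a; have [bj ixj] := inT' b j' leTj'.
have := sim_agent (sim j') bj (etrans ixj iE); rewrite aR.
(* Only a report is compatible with a shadow that has reported. *)
case stE: (agents (cfg j') b) => [w [|d l|d l w'|c' m']|u w [|d l|d l w'|c'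
  m']||w] //=.
- by case: ifP.
- by case.
- by move/(_ erefl).
- by have := nrep j' w b.
Qed.

End Execution.

(** * Probability of passing the hole *)

Section Potential.
Local Open Scope ring_scope.
Variables (R : realType) (q : R).
Hypothesis q01 : 0 <= q <= 1.

Definition remaining (st : progress V) : nat :=
  if stage_of st is Probing k then k else K.

(* Bounds the probability that [x] is ever passed: only its owner can pass it,
   and has to survive [remaining] more coins for that. *)
Definition potential S P cf : R :=
  if passed (boards cf x) then 1 else
  match owner (boards cf x) with
  | None => (1 - q) ^+ K
  | Some d => if agents cf (nth ord0 S d) is Killed then 0
              else (1 - q) ^+ remaining (prog G d (P d))
  end.

Lemma survive_ge0 : 0 <= 1 - q. Proof. by case/andP: q01; lra. Qed.
Lemma survive_le1 : 1 - q <= 1. Proof. by case/andP: q01; lra. Qed.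

Lemma potential_ge0 S P cf : 0 <= potential S P cf.
Proof.
rewrite /potential; case: ifP => // _; case: owner => [d|];
  last exact/exprn_ge0/survive_ge0.
by case: (agents _ _) => // *; exact/exprn_ge0/survive_ge0.
Qed.

Lemma potential_le1 S P cf : potential S P cf <= 1.
Proof.
have r1 n : (1 - q) ^+ n <= 1 by rewrite exprn_ile1 // ?survive_ge0
  ?survive_le1.
rewrite /potential; case: ifP => // _; case: owner => [d|]; last exact: r1.
by case: (agents _ _) => // *; exact: r1.
Qed.

Lemma convex_le (a b c : R) : a <= c -> b <= c -> q * a + (1 - q) * b <= c.
Proof. by move=> ac bc; case/andP: q01 => q0 q1; nra. Qed.

Lemma potential_owner S P cf d : coherent x S P cf -> x != h ->
  (cleared (prog G d (P d)) <= idx G d x < owned (prog G d (P d)))%N ->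
  potential S P cf = if agents cf (nth ord0 S d) is Killed then 0
                     else (1 - q) ^+ remaining (prog G d (P d)).
Proof.
move=> I xh /andP[lec lto]; have xu : x \in us by apply: plan_all.
have [mo pE _] := coherent_marks I xu.
have /eqP oE : owner (boards cf x) == Some d by rewrite mo.
rewrite /potential oE pE (eitherE _ d) ltnNge lec /=; case: ifP => // lt.
have [le1 _ _ _] := marks_bounds (prog G (~~ d) (P (~~ d))).
have : owner (boards cf x) == Some (~~ d) by rewrite mo (leq_trans lt).
by rewrite oE; case: (d).
Qed.

Lemma potential_none S P cf : coherent x S P cf -> x != h ->
  (forall d, (owned (prog G d (P d)) <= idx G d x)%N) ->
  potential S P cf = (1 - q) ^+ K.
Proof.
move=> I xh ge; have xu : x \in us by apply: plan_all.
have [mo pE _] := coherent_marks I xu.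
have np d : (idx G d x < cleared (prog G d (P d)))%N = false.
  have [le1 _ _ _] := marks_bounds (prog G d (P d)).
  by rewrite ltnNge (leq_trans le1 (ge d)).
rewrite /potential pE /either !np /=; case oE: (owner _) => [d|] //.
by have := mo d; rewrite oE eqxx ltnNge ge.
Qed.

Lemma potential_cases S P cf : coherent x S P cf -> x != h ->
  ~~ passed (boards cf x) ->
  (forall d, (owned (prog G d (P d)) <= idx G d x)%N) \/
  exists d, (cleared (prog G d (P d)) <= idx G d x < owned (prog G d (P d)))%N.
Proof.
move=> I xh; have xu : x \in us by apply: plan_all.
have [_ -> _] := coherent_marks I xu; rewrite /either negb_or -!leqNgt =>
  /andP[l r].
have [ge0|lt0] := leqP (owned (prog G false (P false))) (idx G false x).
  have [ge1|lt1] := leqP (owned (prog G true (P true))) (idx G true x).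
    by left=> -[].
  by right; exists true; rewrite r.
by right; exists false; rewrite l.
Qed.

Lemma owned_gt0 S P cf d i : coherent x S P cf ->
  (i < owned (prog G d (P d)) -> d < size S)%N.
Proof.
move=> I lt; rewrite ltnNge; apply/negP => /(coherent_frozen I) P0.
by rewrite P0 prog0 in lt.
Qed.

Lemma advance_bounds (ord : seq V) st ins : valid e h ord st ins ->
  (cleared (advance h K ord st ins) <= owned st)%N /\
  ((owned (advance h K ord st ins) <= owned st)%N \/
   remaining (advance h K ord st ins) = K).
Proof.
case: st => p i; rewrite /owned /remaining.
case: ins => [w|||] [|||k] //= _; rewrite ?addn0 ?addn1;
  try (case: ifP => _ /=); split; auto; lia.
Qed.

Lemma new_progress_cases S P cf b d kill : coherent x S P cf ->
  b \in S -> index b S = d :> nat ->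
  new_progress S P b (stepx b kill cf) d = P d \/
  [/\ new_progress S P b (stepx b kill cf) d = (P d).+1,
     ~~ stopped (agents (stepx b kill cf) b) &
     exists ins r, drop (P d) (scr d) = ins :: r /\
       if ins is Go _ then travels cf b else true].
Proof.
move=> I bS iE; have I' := coherent_step b kill I.
rewrite /new_progress bS iE eqxx /=; have := coherent_explorer I bS iE.
case stE: (agents cf b) => [v s|u v s||t]; last 2 first.
- by rewrite /step stE stE; left.
- by rewrite /step stE stE; left.
- rewrite (step_at _ stE); case: s stE => [|d' k|d' k t|c m] stE //= [dd].
    subst d' => kE vE.
    have kE' ins r : drop k (scr d) = ins :: r -> (inord k.+1 :
      'I_(maxlen G)) = k.+1 :> nat.
      by move=> /progS[_ ltk _]; rewrite inordK //; apply: (lt_maxlen ltk).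
    case dE: (drop k (scr d)) => [|[w|||] r] /=; rewrite ?ffunE ?eqxx;
      first by left.
    + have -> : e v w; last by left.
      rewrite kE in dE; have [_ _] := progS dE; rewrite vE.
      by case: (prog G d (P d)) => p i [|||?] //= /and3P[].
    + case: ifP => _; rewrite /= ffunE eqxx; first by left.
      right; rewrite /= (kE' _ _ dE) kE; split=> //; rewrite -kE;
        by exists Own, r.
    + right; rewrite /= (kE' _ _ dE) kE; split=> //; rewrite -kE;
        by exists Vouch, r.
    + right; rewrite /= (kE' _ _ dE) kE; split=> //; rewrite -kE;
        by exists Pass, r.
  by move=> lek vE _ _; case: eqP => k0 /=; rewrite ffunE eqxx; left; case: ifP.
- case: s stE => [|d' k|d' k t|c m] stE //= [dd];
    rewrite /step stE /= ffunE eqxx.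
    move=> kE uE [r dE]; case: ifP => _ /=; first by left.
    right; rewrite kE; split=> //; exists (Go v), r; by rewrite /travels stE.
  by move=> *; left; case: ifP.
Qed.

(** The potential is a supermartingale whichever agent [b] is scheduled, hence also against an
    adversary that knows all earlier coins. *)
Lemma potential_step S P cf b : coherent x S P cf -> x != h ->
  q * potential (enlist S b) (new_progress S P b (stepx b true cf))
    (stepx b true cf) +
  (1 - q) * potential (enlist S b) (new_progress S P b (stepx b false cf))
              (stepx b false cf) <= potential S P cf.
Proof.
move=> I xh; have xu : x \in us by apply: plan_all.
have I' k := coherent_step b k I.
have [px|npx] := boolP (passed (boards cf x)).
  have pE k : passed (boards (stepx b k cf) x).
    by have [pm _] := boards_mono cf b k x; apply: pm.
  by rewrite /potential !pE px; lra.
(* An agent that is not yet an explorer, or belongs to a copy, leaves the potential unchanged. *)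
have [[bS le1]|nexp] := pselect (b \in S /\ (index b S <= 1)%N); last first.
  have PE k : new_progress S P b (stepx b k cf) = P.
    apply/funext => d; rewrite /new_progress; case: ifP => // /andP[bS /eqP iE].
    by case: nexp; rewrite iE leq_b1.
  suff E k : potential (enlist S b) P (stepx b k cf) = potential S P cf.
    by rewrite !PE !E; lra.
  have {}I' := I' k; rewrite PE in I'.
  have [ge|[d lt]] := potential_cases I xh npx.
    by rewrite (potential_none I xh ge) (potential_none I' xh ge).
  rewrite (potential_owner I xh lt) (potential_owner I' xh lt).
  have ltd : (d < size S)%N by case/andP: lt => _; apply: owned_gt0 I.
  have -> : nth ord0 (enlist S b) d = nth ord0 S d.
    by rewrite /enlist; case: ifP => // _; rewrite nth_rcons ltd.
  rewrite agents_other //; apply/eqP => nE; case: nexp; rewrite -nE mem_nth //.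
  by rewrite index_uniq ?(coherent_uniq I) // leq_b1.
pose d0 := index b S == 1%N.
have iE : index b S = d0 :> nat by rewrite /d0; case: (index b S) le1 => [|[]].
have nthE : nth ord0 S d0 = b by rewrite -iE nth_index.
have SE : enlist S b = S by rewrite /enlist bS.
rewrite SE; have {}I' k : coherent x S (new_progress S P b (stepx b k cf))
  (stepx b k cf).
  by rewrite -[X in coherent x X]SE; apply: I'.
have PnE k : new_progress S P b (stepx b k cf) (~~ d0) = P (~~ d0).
  by rewrite /new_progress iE eqb_nat; case: (d0); rewrite andbF.
have fc k := new_progress_cases k I bS iE.
(* If [x] is unclaimed, the step can at most claim it, and then the full probe of [K] coins lies
   ahead. *)
have [ge|[d lt]] := potential_cases I xh npx.
  rewrite (potential_none I xh ge).
  suff E k : potential S (new_progress S P b (stepx b k cf)) (stepx b k cf)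
    = (1 - q) ^+ K.
    by rewrite !E; lra.
  have [PE|[PE ns [ins [r [dE _]]]]] := fc k.
    apply: potential_none (I' k) xh _ => d.
    have [->|nd] := eqVneq d d0; first by rewrite PE.
    by have -> : d = ~~ d0; [case: (d) (d0) nd => -[] | rewrite PnE].
  have [pE _ vi] := progS dE; have [lec lto] := advance_bounds vi.
  rewrite -pE -PE in lec lto.
  have ged := leq_trans lec (ge d0).
  have [ge'|lt'] := leqP (owned (prog G d0 (new_progress S P b (stepx b k cf)
    d0))) (idx G d0 x).
    apply: potential_none (I' k) xh _ => d.
    have [->//|nd] := eqVneq d d0.
    by have -> : d = ~~ d0; [case: (d) (d0) nd => -[] | rewrite PnE].
  rewrite (potential_owner (I' k) xh (d := d0)) ?ged // nthE.
  case: lto => [lto|->]; first by have := leq_trans lt' (leq_trans lto (ge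
    d0)); rewrite ltnn.
  by case: (agents _ b) ns.
rewrite (potential_owner I xh lt).
have [dd|nd] := eqVneq d d0; last first.
  have dE : d = ~~ d0 by case: (d) (d0) nd => -[].
  suff E k : potential S (new_progress S P b (stepx b k cf)) (stepx b k cf) =
     if agents cf (nth ord0 S d) is Killed then 0 else (1 - q)
       ^+ remaining (prog G d (P d)).
    by rewrite !E; lra.
  rewrite (potential_owner (I' k) xh (d := d)) dE PnE -?dE // agents_other //.
  have ltd : (d < size S)%N by case/andP: lt => _; apply: owned_gt0 I.
  apply/eqP => nE; move: nd; rewrite -eqb_nat -iE -nE index_uniq ?eqxx //.
  exact: coherent_uniq I.
subst d; rewrite nthE.
set st := prog G d0 (P d0).
have notopen : is_open st = false.
  by move: lt; rewrite -/st /owned; case: is_open => //=; rewrite addn0; lia.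
have [xE iX] : nth h (ords G d0) (cleared st) = x /\ idx G d0 x = cleared st.
  have ix : idx G d0 x = cleared st.
    by move: lt; rewrite -/st /owned notopen /=; lia.
  by split=> //; rewrite -ix nth_idx.
have ownE k P' : P' = new_progress S P b (stepx b k cf) ->
    cleared (prog G d0 (P' d0)) = cleared st ->
      is_open (prog G d0 (P' d0)) = false ->
    potential S P' (stepx b k cf) =
    if agents (stepx b k cf) b is Killed then 0
    else (1 - q) ^+ remaining (prog G d0 (P' d0)).
  move=> P'E cE oE; have := I' k; rewrite -P'E => Ik.
  rewrite (potential_owner Ik xh (d := d0)) ?nthE //.
  by rewrite /owned cE oE iX leqnn addn1 ltnSn.
have if_le k n : (if agents (stepx b k cf) b is Killed then 0 else (1 - q)
  ^+ n) <= (1 - q) ^+ n.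
  by case: (agents _ b) => // *; exact/exprn_ge0/survive_ge0.
(* From here on [b] owns [x]. If it completes no move, only [Pass] could raise the potential, but
   this requires that no coin remains, when the potential is already 1. *)
have [tr|ntr] := boolP (travels cf b); last first.
  have [stop|nstop] := boolP (stopped (agents cf b)).
    have E k : stepx b k cf = cf by rewrite /step; case: (agents cf b) stop.
    have FE : new_progress S P b cf = P.
      apply/funext => d; rewrite /new_progress; case: ifP => //.
      by case: (agents cf b) stop.
    by rewrite !E FE (potential_owner I xh lt)
      nthE -mulrDl [q + _]addrC subrK mul1r.
  have -> : (if agents cf b is Killed then 0 else (1 - q) ^+ remaining st)
      = (1 - q) ^+ remaining st by case: (agents cf b) nstop.
  suff le k : potential S (new_progress S P b (stepx b k cf)) (stepx b k cf) <=
      (1 - q) ^+ remaining st by apply: convex_le.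
  have [PE|[PE ns [ins [r [dE go]]]]] := fc k.
    by rewrite (ownE k _ erefl) PE // if_le.
  have [pE _ vi] := progS dE.
  case: ins dE go pE vi => [w|||] dE go pE vi; first by rewrite go in ntr.
  - by move: vi notopen; rewrite -/st; case: (st) => p i [].
  - rewrite (ownE k _ erefl) PE pE; rewrite -/st; move: vi; rewrite -/st;
      case: (st) => p i [] //= _; exact: if_le.
  - move: vi; rewrite -/st; case: (st) => p i [|||[|n]] //= _.
    by rewrite expr0 potential_le1.
have es := coherent_explorer I bS iE.
move: tr es; rewrite {1}/travels; case sE: (agents cf b) =>
  [w s|u v s||w] // _ /=.
case: s sE => [|d' k|d' k t|c m] sE //=; last first.
  by case=> _ _ _ _ [op _]; rewrite -/st notopen in op.
case=> dd; subst d' => kE uE [r dE]; have [pE _ vi] := progS dE.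
rewrite -/st in uE pE vi.
have [cE oE] : cleared (advance h K (ords G d0) st (Go v)) = cleared st /\
    is_open (advance h K (ords G d0) st (Go v)) = false.
  by move: notopen; case: (st) => p i [].
have remE : remaining (advance h K (ords G d0) st (Go v)) =
    if (u == x) || (v == x) then
      (if stage_of st is Probing n then n.-1 else K) else remaining st.
  move: xE notopen uE; rewrite /remaining; case: (st) =>
    p i [|||n] //= xE' _ uE'; last by rewrite xE' uE'.
  by case: ifP.
have FE kl : ((u == x) || (v == x)) && kl = false ->
    agents (stepx b kl cf) b = At v (Forth d0 k) /\
    potential S (new_progress S P b (stepx b kl cf)) (stepx b kl cf) =
      (1 - q) ^+ remaining (advance h K (ords G d0) st (Go v)).
  move=> nokill; have aE : agents (stepx b kl cf) b = At v (Forth d0 k).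
    by rewrite /step sE /= ffunE eqxx nokill.
  have PE : new_progress S P b (stepx b kl cf) d0 = (P d0).+1.
    by rewrite /new_progress bS iE eqxx /= aE kE.
  by split=> //; rewrite (ownE kl _ erefl) PE pE ?aE.
have [_ potf] := FE false (andbF _); rewrite potf.
(* On a move that touches [x], death gives potential 0, while survival has probability [1 - q] and
   removes at most one factor [1 - q]. *)
have [touch|notouch] := boolP ((u == x) || (v == x)); last first.
  have [|_ pott] := FE true; first by rewrite (negPf notouch).
  by rewrite pott remE (negPf notouch); lra.
have aE : agents (stepx b true cf) b = Killed.
  by rewrite /step sE /= ffunE eqxx touch.
have PE : new_progress S P b (stepx b true cf) d0 = P d0.
  by rewrite /new_progress bS iE eqxx /= aE.
rewrite (ownE true _ erefl) PE // aE mulr0 add0r -exprS.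
rewrite remE touch /remaining; apply: ler_wiXn2l;
  rewrite ?survive_ge0 ?survive_le1 //.
by case: (stage_of st) => // n; exact: leqSpred.
Qed.

End Potential.

(** * Dependence of a run on finitely many coins *)

Section Prefixes.
Variable adv : adversary Ar.

Lemma run_ext (c1 c2 : nat -> bool) n : (forall i, (i < n)%N -> c1 i = c2 i) ->
  [/\ run e h x adv c1 n = run e h x adv c2 n,
      enlisted adv c1 n = enlisted adv c2 n &
      progress_at adv c1 n = progress_at adv c2 n].
Proof.
elim: n => [|n IH] cE; first by [].
have [|rE eE pE] := IH; first by move=> i lti; apply: cE; apply: ltnW.
have mE : mkseq c1 n = mkseq c2 n.
  by apply/eq_in_map => i; rewrite mem_iota => /andP[_ lti]; apply: cE;
    apply: ltnW.
have cn : c1 n = c2 n by apply: cE.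
by split=> /=; rewrite ?rE ?eE ?pE mE ?cn.
Qed.

Definition prefix_run (s : seq bool) := run e h x adv (nth true s) (size s).

Lemma prefix_runE (c1 : nat -> bool) n : run e h x adv c1 n = prefix_run (mkseq
  c1 n).
Proof.
rewrite /prefix_run size_mkseq; have [] := @run_ext c1 (nth true (mkseq c1 n))
  n => //.
by move=> i lti; rewrite nth_mkseq.
Qed.

End Prefixes.

(** * Measurability and the error probability *)

Section Chance.
Local Open Scope ring_scope.
Local Open Scope classical_set_scope.
Variables (R : realType) (q : R).
Hypothesis q01 : 0 <= q <= 1.
Variable adv : adversary Ar.
Variables (dsp : measure_display) (Omega : measurableType dsp).
Variables (Pr : probability Omega R) (coin : nat -> Omega -> bool).
Hypothesis indep : independent_coins Pr q coin.
Hypothesis x_neq_h : x != h.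

Lemma measurable_coins n (D : seq bool -> Prop) :
  measurable [set om | D (mkseq (coin ^~ om) n)].
Proof.
elim: n D => [|n IH] D.
  have [d0|nd0] := pselect (D [::]).
    by rewrite (_ : [set om | _] = setT) //; apply/seteqP; split.
  by rewrite (_ : [set om | _] = set0) //; apply/seteqP; split.
have mS om : mkseq (coin ^~ om) n.+1 = rcons (mkseq (coin ^~ om) n) (coin n om).
  by rewrite /mkseq -addn1 iotaD map_cat cats1.
have mn := indep.1 n.
rewrite (_ : [set om | _] =
  ([set om | coin n om] `&` [set om | D (rcons (mkseq (coin ^~ om) n) true)])
    `|`
  (~` [set om | coin n om] `&` [set om | D (rcons (mkseq (coin ^~ om) n)
    false)])).
  apply: measurableU; apply: measurableI => //; last 2 first.
  - exact: measurableC.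
  - exact: (IH (fun s => D (rcons s false))).
  exact: (IH (fun s => D (rcons s true))).
apply/seteqP; split=> om /=; rewrite mS.
  by case cE: (coin n om); [left | right].
by case=> -[]; case: (coin n om).
Qed.

Lemma measurable_run n (Q : config Ar -> Prop) :
  measurable [set om | Q (run e h x adv (coin ^~ om) n)].
Proof.
rewrite (_ : [set om | _] = [set om | (Q \o prefix_run adv) (mkseq (coin ^~ om)
  n)]).
  exact: measurable_coins.
by apply/seteqP; split=> om /=; rewrite prefix_runE.
Qed.

Definition cylinder (s : seq bool) :=
  [set om | forall i, (i < size s)%N -> coin i om = nth true s i].

Definition weight (s : seq bool) : R :=
  \prod_(i < size s) (if nth true s i then q else 1 - q).

Lemma Pr_cylinder s : Pr (cylinder s) = (weight s)%:E.
Proof. exact: (indep.2 (size s) (nth true s)). Qed.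

Lemma weight_ge0 s : 0 <= weight s.
Proof. by apply: prodr_ge0 => i _; case: ifP => _;
  [case/andP: q01 | exact: survive_ge0 q01]. Qed.

Lemma weight_rcons s (b : bool) : weight (rcons s b)
  = weight s * (if b then q else 1 - q).
Proof.
rewrite /weight size_rcons big_ord_recr /= nth_rcons ltnn eqxx; congr (_ * _).
by apply: eq_bigr => i _; rewrite nth_rcons ltn_ord.
Qed.

Lemma cylinderE s : cylinder s = [set om | mkseq (coin ^~ om) (size s) = s].
Proof.
apply/seteqP; split=> om /= ws.
  apply: (@eq_from_nth _ true); rewrite size_mkseq // => i lti.
  by rewrite nth_mkseq // ws.
by move=> i lti; rewrite -[in RHS]ws nth_mkseq.
Qed.

Lemma measurable_cylinder s : measurable (cylinder s).
Proof. by rewrite cylinderE; apply: (measurable_coins _ (fun l => l = s)). Qed.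

Definition bad n := [set om | passed (boards (run e h x adv (coin ^~ om) n) x)].

Lemma measurable_bad n : measurable (bad n).
Proof. exact: (measurable_run n (fun cf => passed (boards cf x))). Qed.

Definition prefix_potential s :=
  potential q (enlisted adv (nth true s) (size s))
    (progress_at adv (nth true s) (size s)) (prefix_run adv s).

Lemma prefix_potential_step s :
  q * prefix_potential (rcons s true) + (1 - q)
    * prefix_potential (rcons s false)
  <= prefix_potential s.
Proof.
pose n := size s; pose a := adv (mkseq (nth true s) n).
have := potential_step q01 a (coherent_run adv (nth true s) n) x_neq_h.
suff E (b : bool) : prefix_potential (rcons s b) =
    let cf := stepx a b (prefix_run adv s) in
    potential q (enlist (enlisted adv (nth true s) n) a)
      (new_progress (enlisted adv (nth true s) n)
         (progress_at adv (nth true s) n) a cf) cf by rewrite !E.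
have cE i : (i < size s)%N -> nth true (rcons s b) i = nth true s i.
  by move=> lti; rewrite nth_rcons lti.
have [rE eE pE] := run_ext adv cE.
have mE : mkseq (nth true (rcons s b)) (size s) = mkseq (nth true s) (size s).
  by apply/eq_in_map => i; rewrite mem_iota => /andP[_ lti]; apply: cE.
rewrite /a /n /prefix_potential /prefix_run size_rcons /= rE eE pE mE.
by rewrite nth_rcons ltnn eqxx.
Qed.

(** Induction on the number of further steps: split the cylinder by the next coin and apply the
    supermartingale inequality. At the end the potential is 1 if the hole has been passed. *)
Lemma Pr_bad_cylinder n s :
  (Pr (cylinder s `&` bad (size s + n)%N) <= (weight s * prefix_potential
    s)%:E)%E.
Proof.
elim: n s => [|n IH] s.
  rewrite addn0; have [ps|nps] := boolP (passed (boards (prefix_run adv s) x)).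
    rewrite (_ : prefix_potential s = 1); last
      by rewrite /prefix_potential /potential ps.
    rewrite mulr1 -Pr_cylinder; apply: le_measure; rewrite ?inE //.
    - by apply: measurableI; [exact: measurable_cylinder | exact:
        measurable_bad].
    - exact: measurable_cylinder.
  rewrite (_ : _ `&` _ = set0) ?measure0 ?lee_fin.
    by rewrite mulr_ge0 ?weight_ge0 ?potential_ge0.
  apply/seteqP; split=> om // []; rewrite cylinderE /bad /= => sE.
  by rewrite prefix_runE sE (negPf nps).
have sub : cylinder s `&` bad (size s + n.+1)%N `<=`
   (cylinder (rcons s true) `&` bad (size (rcons s true) + n)%N) `|`
   (cylinder (rcons s false) `&` bad (size (rcons s false) + n)%N).
  move=> om [cs]; rewrite !size_rcons addSnnS => bw.
  have cyl : cylinder (rcons s (coin (size s) om)) om.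
    move=> i; rewrite size_rcons ltnS leq_eqVlt nth_rcons => /orP[/eqP->|lti].
      by rewrite ltnn eqxx.
    by rewrite lti cs.
  by case: (coin _ _) cyl; [left | right].
have mcb (b : bool) : measurable (cylinder (rcons s b)
  `&` bad (size (rcons s b) + n)%N).
  by apply: measurableI; [exact: measurable_cylinder | exact: measurable_bad].
apply: (le_trans (le_measure Pr _ _ sub)); rewrite ?inE.
- by apply: measurableI; [exact: measurable_cylinder | exact: measurable_bad].
- exact: measurableU.
apply: (le_trans (measureU2 _ _ _)) => //.
apply: (le_trans (leeD (IH _) (IH _))).
rewrite -EFinD lee_fin !weight_rcons -!mulrA -mulrDr.
by apply: ler_wpM2l; [exact: weight_ge0 | exact: prefix_potential_step].
Qed.

Lemma Pr_bad n : (Pr (bad n) <= ((1 - q) ^+ K)%:E)%E.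
Proof.
have := Pr_bad_cylinder n [::].
rewrite (_ : cylinder [::] = setT); last by apply/seteqP; split.
rewrite setTI /weight big_ord0 mul1r; congr (_ <= _)%E; congr (_ %:E).
by rewrite /prefix_potential /potential /= ffunE.
Qed.

(** For [q = 1] fairness is only required along coins that all kill, so the other sequences are
    removed as a null event. *)
Definition impossible n : set Omega :=
  [set om | q = 1 /\ exists2 i, (i < n)%N & ~~ coin i om].

Lemma measurable_impossible n : measurable (impossible n).
Proof.
have := measurable_coins n (fun l => q = 1 /\ exists2 i,
  (i < n)%N & ~~ nth true l i).
congr (measurable _); apply/seteqP; split=> om [q1 [i lti ci]]; split=> //;
  by exists i => //; move: ci; rewrite nth_mkseq.
Qed.

Lemma Pr_impossible n : Pr (impossible n) = 0%E.
Proof.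
have [q1|nq1] := pselect (q = 1); last first.
  rewrite (_ : impossible n = set0) ?measure0 //.
  by apply/seteqP; split=> om // [].
rewrite (_ : impossible n = ~` cylinder (nseq n true)); last first.
  apply/seteqP; split=> om /=.
    move=> [_ [i lti ci]] /(_ i); rewrite size_nseq nth_nseq lti => /(_ isT) ct.
    by rewrite ct in ci.
  move=> ncyl; split=> //; apply: contrapT => nex; apply: ncyl => i.
  rewrite size_nseq nth_nseq => lti; rewrite lti; apply: contrapT => /negP ci.
  by apply: nex; exists i.
rewrite probability_setC; last exact: measurable_cylinder.
rewrite Pr_cylinder /weight size_nseq big1 => [|i _].
  by rewrite subee.
by rewrite nth_nseq ltn_ord.
Qed.

Lemma Pr_correct t m : solves_BHS R e h A t m -> fair q adv ->
  ((1 - (1 - q) ^+ K)%:E <=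
   Pr [set om | correct_output x (run e h x adv (coin ^~ om))])%E.
Proof.
move=> sol fr; pose F n := bad n `|` impossible n.
have mF n : measurable (F n).
  by apply: measurableU; [exact: measurable_bad | exact: measurable_impossible].
have mU : measurable (\bigcup_n F n) by apply: bigcupT_measurable.
have F_mono : nondecreasing_seq F.
  move=> i j leij; apply/subsetPset => om [].
    by move=> /(passed_run leij); left.
  by move=> [q1 [k ltk ck]]; right; split=> //; exists k => //;
    apply: leq_trans leij.
(* The bound holds at each time [n], and passes to the increasing union by continuity from below. *)
have PrU : (Pr (\bigcup_n F n) <= ((1 - q) ^+ K)%:E)%E.
  have cv := nondecreasing_cvg_mu (mu := Pr) mF mU F_mono.
  rewrite -(cvg_lim _ cv) //; apply: lime_le.
    by apply/cvg_ex; eexists; exact: cv.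
  apply: nearW => n /=; apply: le_trans (measureU2 _ _ _) _.
  - exact: measurable_bad.
  - exact: measurable_impossible.
  - have im0 : (Pr (impossible n) <= 0)%E by rewrite Pr_impossible.
    by apply: le_trans (leeD (Pr_bad n) im0) _; rewrite adde0.
have mC : measurable [set om | correct_output x (run e h x adv (coin ^~ om))].
  rewrite (_ : [set om | _] =
    (\bigcup_i [set om | reported (run e h x adv (coin ^~ om) i) x]) `&`
    (\bigcap_i [set om | forall y, reported (run e h x adv (coin ^~ om) i) y ->
      y = x])).
    apply: measurableI.
      apply: bigcupT_measurable => i; exact: (measurable_run i (fun cf =>
        reported cf x)).
    apply: bigcapT_measurable => i.
    exact: (measurable_run i (fun cf => forall y, reported cf y -> y = x)).
  apply/seteqP; split=> om /=.
    by move=> [[i ri] ro]; split=> [|i0 _ y]; [exists i | apply: ro].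
  by move=> [[i _ ri] ro]; split=> [|j y]; [exists i | apply: ro].
apply: (@le_trans _ _ (Pr (~` \bigcup_n F n))).
  by rewrite probability_setC // EFinB; apply: leeB.
apply: le_measure; rewrite ?inE //; first exact: measurableC.
(* Off this union the hole is never passed and the coins are possible, so the run terminates with a
   correct output. *)
move=> om nU /=.
have np i : ~~ passed (boards (run e h x adv (coin ^~ om) i) x).
  by apply/negP => pi; apply: nU; exists i => //; left.
have pos : possible_coins q (coin ^~ om).
  move=> q1 i; apply: contrapT => /negP ci; apply: nU; exists i.+1 => //.
  by right; split=> //; exists i.
have fs a i : exists2 j, (i <= j)%N & adv (mkseq (coin ^~ om) j) = a by exact:
  fr.
have [i [y ri]] := terminates_run fs sol x_neq_h.
have rE j w : reported (run e h x adv (coin ^~ om) j) w -> w = x.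
  by apply: reported_correct sol x_neq_h (np j).
by split=> [|j w]; [exists i; rewrite -{2}(rE _ _ ri) | exact: rE].
Qed.

End Chance.

End Runs.

(** * Estimates for [Delta], and the theorem *)

Local Open Scope ring_scope.

Lemma Delta_ge0 (R : realType) (p delta : R) : 0 < p <= 1 -> 0 < delta <= 1 ->
  0 <= Delta p delta.
Proof.
move=> /andP[p0 p1] /andP[d0 d1]; rewrite /Delta; case: eqVneq => // np1.
have l1 : ln (1 - p) <= 0 by apply: ln_le0; lra.
have l2 : ln delta <= 0 by apply: ln_le0.
by rewrite -mulrNN mulr_ge0 // -?invrN ?invr_ge0; lra.
Qed.

(** Follows from [p <= - ln (1 - p)]. *)
Lemma Delta_le (R : realType) (p delta : R) : 0 < p <= 1 -> 0 < delta <= 1 ->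
  Delta p delta <= ln delta^-1 / p.
Proof.
move=> /andP[p0 p1] /andP[d0 d1]; rewrite /Delta.
have ld : 0 <= ln delta^-1 by rewrite lnV ?posrE // oppr_ge0 ln_le0.
case: eqVneq => [_|np1]; first by rewrite divr_ge0 // ltW.
have lp : 0 < 1 - p by rewrite subr_gt0 lt_neqAle np1.
have l1 : p <= - ln (1 - p) by have := @le_ln1Dx R (- p); lra.
rewrite -mulrNN -invrN -lnV ?posrE //; apply: ler_wpM2l => //.
by rewrite lef_pV2 ?posrE //; lra.
Qed.

(** As [ln (1 - p)] is negative, [Delta < K] bounds [K ln (1 - p)] by [ln delta]. For [p = 1] no
    coin is survived, and [0 < K] suffices. *)
Lemma expn_Delta_le (R : realType) (p q delta : R) (K : nat) :
  0 < p <= 1 -> 0 < delta <= 1 -> p <= q <= 1 -> Delta p delta < K%:R ->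
  (1 - q) ^+ K <= delta.
Proof.
move=> pP dP /andP[pq q1] ltK; have D0 := Delta_ge0 pP dP.
case/andP: pP dP => p0 p1 /andP[d0 d1].
have K0 : (0 < K)%N by rewrite -(ltr0n R); apply: le_lt_trans ltK.
move: ltK; rewrite /Delta; case: eqVneq => [pE|np1] ltK.
  rewrite (_ : 1 - q = 0); last by lra.
  by rewrite expr0n eqn0Ngt K0 /= ltW.
have lp : 0 < 1 - p by rewrite subr_gt0 lt_neqAle np1.
have ln0 : ln (1 - p) < 0 by rewrite ln_lt0 //; lra.
apply: (@le_trans _ _ ((1 - p) ^+ K)).
  by apply: lerXn2r; rewrite ?nnegrE; lra.
rewrite -ler_ln ?posrE ?exprn_gt0 // lnXn // -mulr_natl.
by move: ltK; rewrite ltr_ndivrMr // => /ltW.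
Qed.

Lemma size_first_visits (V : eqType) (w : seq V) :
  (size (first_visits w) <= size w)%N.
Proof. by rewrite size_rev -(size_rev w) size_undup. Qed.

Theorem theorem1 (R : realType) :
  exists C : nat, forall c : nat, exists c' : nat,
  forall (V : finType) (e : rel V) (h v : V) (A : protocol V) (t m : nat)
         (pi : seq V * seq V) (p delta : R),
    symmetric e -> irreflexive e -> biconnected e -> e h v ->
    (#|board A| <= #|V| ^ c)%N ->
    solves_BHS R e h A t m ->
    traversal_pair e h v pi ->
    0 < p <= 1 -> 0 < delta <= 1 ->
    (exists Ar : protocol V,
       (#|board Ar| <= #|V| ^ c')%N /\
       solves_rBHS e h Ar p delta (2 * t + 2)
         (C%:R * (m%:R + (traversal_size pi)%:R + Delta p delta * #|V|%:R))) /\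
    Delta p delta <= C%:R * (ln delta^-1 / p).
Proof.
(* The two sheets contribute [2 * c] to the exponent, and [48 <= 2 ^ 6] the rest, as there are at
   least two nodes. The constant 250 covers [2 m + 248 S + 48 Delta n], the final estimate. *)
exists 250%N => c; exists (2 * c + 6)%N => V e h v A t m pi p delta symE irrE _
  ehv
  leB sol [vs [perm_vs path_l path_r fv_l fv_r]] pP dP.
have D0 := Delta_ge0 pP dP; have DL := Delta_le pP dP.
split; last by have := le_trans D0 DL; lra.
(* Strictly above [Delta], and positive even if [Delta] is 0. *)
set K := (Num.truncn (Delta p delta)).+1.
have [leK ltK] : (K%:R <= Delta p delta + 1) /\ (Delta p delta < K%:R).
  have /andP[le lt] := Num.Theory.truncn_itv D0; split=> //.
  by rewrite /K -natr1 lerD2r.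
pose us := behead vs.
have vsE : vs = h :: us by rewrite /us -fv_l first_visits_cons.
have uniq_vs : uniq (h :: us) by rewrite -vsE (perm_uniq perm_vs) enum_uniq.
have nh : h \notin us by case/andP: uniq_vs.
have in_us u : u != h -> u \in us.
  by move=> uh; have := mem_enum V u; rewrite -(perm_mem perm_vs)
    vsE in_cons (negPf uh).
have vh : v != h by apply: contraTneq ehv => ->; rewrite irrE.
have us0 : (0 < size us)%N by case: (us) (in_us v vh).
have cardV : #|V| = (size us).+1 by rewrite cardE -(perm_size perm_vs) vsE.
have le_l : (size us <= size pi.1)%N.
  by have := size_first_visits (h :: pi.1); rewrite fv_l vsE /=.
have usF : [seq z <- us | z \notin [:: h]] = us.
  by apply/all_filterP/allP => z zu; rewrite inE; apply: contraTneq zu => ->.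
have filt u w : first_visits (u :: w) = vs ->
    [seq z <- first_visits w | z \notin [:: h]] = us.
  rewrite first_visits_cons vsE => -[-> fE]; rewrite -[RHS]fE.
  by apply: eq_filter => z; rewrite inE.
have le_r : (size us <= size pi.2)%N.
  by have := size_first_visits (v :: pi.2); rewrite fv_r size_rev vsE /=.
have fvr : [seq z <- first_visits (v :: pi.2) | z \notin [:: h]] = rev us.
  by rewrite fv_r vsE rev_cons filter_rcons inE eqxx /= -[in RHS]usF filter_rev.
have uniq_r : uniq (h :: rev us) by rewrite cons_uniq mem_rev rev_uniq
  -cons_uniq.
have us0r : (0 < size (rev us))%N by rewrite size_rev.
have sub0 (ord : seq V) : {subset [::] <= known h ord 0} by [].
have filt0 (ord : seq V) w : [seq z <- first_visits w | z \notin [::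
  h]] = ord ->
    [seq z <- first_visits w | z \notin known h ord 0] = drop 0 ord.
  by rewrite /known take0 drop0.
(* The edge from [h] to [v] is prepended to the second walk, so that both explorers start at [h]. *)
have path_r' : path e h (v :: pi.2) by rewrite /= ehv.
have [s0 fs0 le0] := script_exists K symE uniq_vs us0 erefl (isT :
  path e h [::])
  (sub0 us) path_l (filt0 _ _ (filt _ _ fv_l)).
have [s1 fs1 le1] := script_exists K symE uniq_r us0r erefl (isT :
  path e h [::])
  (sub0 (rev us)) path_r' (filt0 _ _ fvr).
rewrite /= muln0 add0n subn0 in le0; rewrite /= muln0 add0n subn0 size_rev in
  le1.
have fs (d : bool) : follows e h K (if d then rev us else us)
  (Progress h 0 Walking)
    (if d then s1 else s0) by case: d.
pose G := Plan symE uniq_vs in_us us0 fs.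
exists (search_protocol G A); split.
  apply: leq_trans (card_whiteboard _) _; rewrite expnD mulnC.
  apply: leq_mul; first by rewrite mulnC expnM leq_sqr.
  by apply: (@leq_trans (2 ^ 6)) => //; rewrite leq_exp2r // cardV.
split.
  by rewrite nagents_Ar -addn2 leq_add2r -mul2n leq_mul2l; case: sol => ->.
move=> x xh q pq adv fr.
have q01 : 0 <= q <= 1 by case/andP: pP pq => p0 _ /andP[pq ->];
  rewrite (le_trans (ltW p0)).
split; last first.
  move=> dsp Omega Pr coin indep; apply: le_trans (Pr_correct q01 indep xh sol
    fr).
  by rewrite lee_fin lerD2l lerN2; apply: expn_Delta_le pq ltK.
move=> coin pos; split.
  have fs' a i : exists2 j, (i <= j)%N & adv (mkseq coin j) = a by exact: fr.
  by have term := terminates_run fs' sol xh; apply: term.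
move=> i; have := moves_bound x adv coin i sol.
rewrite /maxlen /=; move: (moves _) => n len.
set S := traversal_size pi.
have [leS0 leS1] : (size pi.1 <= S)%N /\ (size pi.2 <= S)%N by rewrite leq_maxl
  leq_maxr.
(* Two scripts with [2 * K] bounces per target, weighted by 12, give 48; all lower terms are
   absorbed by [0 < size us <= S]. *)
have len' : (n <= 2 * m + 200 * S + 48 * (K * size us))%N.
  move: len le0 le1 le_l leS0 leS1 (us0); rewrite !mulnDl -!mulnA.
  by move: (K * size us)%N => KN; clear; lia.
have lenR : n%:R <= 2%:R * m%:R + 200%:R * S%:R + 48%:R * (K%:R * (size us)%:R)
  :> R.
  by rewrite -!natrM -!natrD ler_nat.
apply: le_trans lenR _; rewrite cardV -[(size us).+1%:R]natr1 (mulrDr (Delta p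
  delta)) mulr1.
have leKN : K%:R * (size us)%:R <= Delta p delta * (size us)%:R + S%:R :> R.
  apply: (@le_trans _ _ ((Delta p delta + 1) * (size us)%:R)).
    by apply: ler_wpM2r.
  by rewrite mulrDl mul1r lerD2l ler_nat (leq_trans le_l).
have DN : 0 <= Delta p delta * (size us)%:R by rewrite mulr_ge0.
have m0 : 0 <= m%:R :> R by [].
have S0 : 0 <= S%:R :> R by [].
by lra.
Qed.
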